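(* Let $s\in(1/2,1)$ and let $\Omega\subset\mathbb{R}^N$ be a bounded $C^2$ domain. The trace Dirichlet problem $$-\sum_{i=1}^N\Lambda_i^s u(x)=0\ \ (x\in\Omega),\qquad u(x)=g(x)\ \ (x\in\mathbb{R}^N\setminus\Omega),$$ and the mid-range Dirichlet problem $$\Lambda_1^s u(x)+\Lambda_N^s u(x)=0\ \ (x\in\Omega),\qquad u(x)=g(x)\ \ (x\in\mathbb{R}^N\setminus\Omega),$$ are nonlinear problems. For each of them there exist continuous bounded exterior data $g_1,g_2:\mathbb{R}^N\setminus\Omega\to\mathbb{R}$ such that $$g_1\gneqq g_2\quad\text{in }\mathbb{R}^N\setminus\Omega$$ (that is, $g_1\ge g_2$ and $g_1\not\equiv g_2$), but the corresponding viscosity solutions $u_1,u_2$ (with exterior data $g_1,g_2$ respectively) satisfy $$u_1\equiv u_2\quad\text{in }\Omega.$$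
   Context: Fractional eigenvalues: for $i=1,\dots,N$, formally $$\Lambda_i^s u(x)=\max_{\dim S=N-i+1}\ \min_{z\in S,\,|z|=1}\left\{c(s)\,\mathrm{p.v.}\int_{\mathbb{R}}\frac{u(x+tz)-u(x)}{|t|^{1+2s}}\,dt\right\},$$ where $S$ ranges over linear subspaces of $\mathbb{R}^N$ of the indicated dimension and $c(s)=\frac{2^{2s}s\Gamma(s+1/2)}{\pi^{1/2}\Gamma(1-s)}>0$. Since the right-hand sides are $0$, the factor $c(s)$ plays no role and is dropped in the definition of solution below. For bounded $C^2$ domains and continuous bounded exterior data each of the two problems has a unique viscosity solution. Extensions: for a function $u$ defined (at least) on $\overline{\Omega}$, the upper $g$-extension $u^g:\mathbb{R}^N\to\mathbb{R}$ is $u^g=u$ in $\Omega$, $u^g=g$ in $\mathbb{R}^N\setminus\overline{\Omega}$, $u^g=\max\{u,g\}$ on $\partial\Omega$. The lower $g$-extension $u_g$ is defined in the same way with $\min$ in place of $\max$ on $\partial\Omega$. For $\delta>0$, a unit vector $z$, a bounded function $w$ on $\mathbb{R}^N$ and $\phi\in C^2(\mathbb{R}^N)$, set $$E_{z,\delta}(w,\phi,x)=\mathrm{p.v.}\int_{-\delta}^{\delta}\frac{\phi(x+tz)-\phi(x)}{|t|^{1+2s}}dt+\int_{\mathbb{R}\setminus(-\delta,\delta)}\frac{w(x+tz)-w(x)}{|t|^{1+2s}}dt .$$ For the trace problem put $$E_\delta(w,\phi,x)=-\sum_{i=1}^N\ \sup_{\dim S=N-i+1}\ \inf_{z\in S,\,|z|=1}E_{z,\delta}(w,\phi,x);$$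 for the mid-range problem put $$E_\delta(w,\phi,x)=-\Big[\inf_{|z|=1}E_{z,\delta}(w,\phi,x)+\sup_{|z|=1}E_{z,\delta}(w,\phi,x)\Big].$$ Viscosity solutions (for either problem, with the corresponding $E_\delta$): a bounded upper semicontinuous $u:\mathbb{R}^N\to\mathbb{R}$ is a viscosity subsolution if $u\le g$ in $\mathbb{R}^N\setminus\overline{\Omega}$ and, whenever $\delta>0$ and $\phi\in C^2(\mathbb{R}^N)$ are such that $x_0$ is a maximum point of $u-\phi$ in $B_\delta(x_0)$, one has $E_\delta(u^g,\phi,x_0)\le0$ if $x_0\in\Omega$, and $\min\{E_\delta(u^g,\phi,x_0),\,u(x_0)-g(x_0)\}\le0$ if $x_0\in\partial\Omega$. A bounded lower semicontinuous $v:\mathbb{R}^N\to\mathbb{R}$ is a viscosity supersolution if $v\ge g$ in $\mathbb{R}^N\setminus\overline{\Omega}$ and, whenever $x_0$ is a minimum point of $v-\phi$ in $B_\delta(x_0)$, one has $E_\delta(v_g,\phi,x_0)\ge0$ if $x_0\in\Omega$, and $\max\{E_\delta(v_g,\phi,x_0),\,v(x_0)-g(x_0)\}\ge0$ if $x_0\in\partial\Omega$. A viscosity solution is a function that is both a viscosity subsolution and a viscosity supersolution.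
   Formalization: The dimension is taken to be N ≥ 2; for N = 1 both problems reduce to the linear Dirichlet problem for the one-dimensional fractional Laplacian, for which both the nonlinearity and the existence of such g_1, g_2 fail. *)

(* Defs.v *)
From HB Require Import structures.
From mathcomp Require Import all_boot all_order all_algebra.
From mathcomp Require Import all_classical all_reals all_analysis.

Set Implicit Arguments.
Unset Strict Implicit.
Unset Printing Implicit Defensive.

Import Order.TTheory GRing.Theory Num.Theory numFieldNormedType.Exports.

Local Open Scope classical_set_scope.
Local Open Scope ring_scope.

Section EuclideanSpace.
Context {R : realType} {N : nat}.
Implicit Types (x y : 'rV[R]_N) (phi : 'rV[R]_N -> R).

(* The library norm on 'rV[R]_N is the sup norm: it induces the same topology
   and the same bounded sets, but unit vectors and balls need this one. *)
Definition enorm x : R := Num.sqrt (\sum_(i < N) x 0 i ^+ 2).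

Definition eball x (r : R) : set 'rV[R]_N := [set y | enorm (y - x) < r].

Definition frontier (A : set 'rV[R]_N) := closure A `\` interior A.

Definition C1 phi : Prop := forall i : 'I_N,
  (forall x, derivable phi x (delta_mx 0 i)) /\
  continuous ('D_(delta_mx 0 i) phi).

Definition C2 phi : Prop :=
  C1 phi /\ forall i : 'I_N, C1 ('D_(delta_mx 0 i) phi).

Definition upper_semicontinuous (u : 'rV[R]_N -> R) : Prop :=
  lower_semicontinuous (fun x => (- u x)%:E).

End EuclideanSpace.

(* Near each boundary point, after relabelling (i) and reorienting (b) the
   coordinate axes, Omega is the set above the graph of a C^2 function of the
   N - 1 other coordinates. *)
Definition bounded_C2_domain (R : realType) (N : nat)
    (Omega : set 'rV[R]_N) : Prop :=
  [/\ Omega !=set0, open Omega, connected Omega, bounded_set Omega &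
      forall x0, frontier Omega x0 ->
        exists (i : 'I_N) (b : bool) (gamma : 'rV[R]_(N.-1) -> R) (r : R),
          [/\ C2 gamma, 0 < r &
              forall x, eball x0 r x ->
                Omega x <-> gamma (col' i x) < (-1) ^+ b * x 0 i]].

(* g is only meaningful off Omega; its values in Omega are never used. *)
Definition exterior_datum (R : realType) (N : nat) (Omega : set 'rV[R]_N)
    (g : 'rV[R]_N -> R) : Prop :=
  {within ~` Omega, continuous g} /\ [bounded g x | x in ~` Omega].

Section NonlocalOperators.
Context {R : realType} {N : nat}.
Variable s : R.
Implicit Types (x z : 'rV[R]_N) (w phi : 'rV[R]_N -> R) (delta : R).

Definition kernel_quotient w x z (t : R) : R :=
  (w (x + t *: z) - w x) / `|t| `^ (1 + 2 * s).

Definition E_dir z delta w phi x : R :=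
  lim ((\int[lebesgue_measure]_(t in [set t : R | eps < `|t| < delta])
          kernel_quotient phi x z t) @[eps --> 0^'+]) +
  \int[lebesgue_measure]_(t in [set t : R | delta <= `|t|])
     kernel_quotient w x z t.

Definition sphere (S : {vspace 'rV[R]_N}) : set 'rV[R]_N :=
  [set z | z \in S /\ enorm z = 1].

Definition maxmin (F : 'rV[R]_N -> R) (i : nat) : R :=
  sup [set inf (F @` sphere S) |
       S in [set S : {vspace 'rV[R]_N} | \dim S = (N - i + 1)%N]].

Definition E_trace delta w phi x : R :=
  - \sum_(1 <= i < N.+1) maxmin (fun z => E_dir z delta w phi x) i.

Definition E_midrange delta w phi x : R :=
  - (inf [set E_dir z delta w phi x | z in [set z | enorm z = 1]] +
     sup [set E_dir z delta w phi x | z in [set z | enorm z = 1]]).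

End NonlocalOperators.

Variant dirichlet_problem := TraceProblem | MidRangeProblem.

Definition E_op (R : realType) (N : nat) (p : dirichlet_problem) (s : R) :
    R -> ('rV[R]_N -> R) -> ('rV[R]_N -> R) -> 'rV[R]_N -> R :=
  match p with
  | TraceProblem => E_trace s
  | MidRangeProblem => E_midrange s
  end.

Section ViscositySolutions.
Context {R : realType} {N : nat}.
Variables (p : dirichlet_problem) (s : R) (Omega : set 'rV[R]_N).
Implicit Types (g u v phi : 'rV[R]_N -> R) (x : 'rV[R]_N).

Definition upper_ext g u x : R :=
  if x \in Omega then u x
  else if x \in frontier Omega then Num.max (u x) (g x) else g x.

Definition lower_ext g u x : R :=
  if x \in Omega then u x
  else if x \in frontier Omega then Num.min (u x) (g x) else g x.

Definition viscosity_subsolution g u : Prop :=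
  [/\ bounded_fun u, upper_semicontinuous u,
      forall x, ~ closure Omega x -> u x <= g x &
      forall (delta : R) phi x0, 0 < delta -> C2 phi ->
        (forall y, eball x0 delta y -> u y - phi y <= u x0 - phi x0) ->
        (Omega x0 -> E_op p s delta (upper_ext g u) phi x0 <= 0) /\
        (frontier Omega x0 ->
           Num.min (E_op p s delta (upper_ext g u) phi x0)
                   (u x0 - g x0) <= 0)].

Definition viscosity_supersolution g v : Prop :=
  [/\ bounded_fun v, lower_semicontinuous (fun x => (v x)%:E),
      forall x, ~ closure Omega x -> g x <= v x &
      forall (delta : R) phi x0, 0 < delta -> C2 phi ->
        (forall y, eball x0 delta y -> v x0 - phi x0 <= v y - phi y) ->
        (Omega x0 -> 0 <= E_op p s delta (lower_ext g v) phi x0) /\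
        (frontier Omega x0 ->
           0 <= Num.max (E_op p s delta (lower_ext g v) phi x0)
                        (v x0 - g x0))].

Definition viscosity_solution g u : Prop :=
  viscosity_subsolution g u /\ viscosity_supersolution g u.

Definition the_viscosity_solution g u : Prop :=
  viscosity_solution g u /\ forall v, viscosity_solution g v -> v =1 u.

(* The equation has zero right-hand side, so linearity of the Dirichlet problem
   is the superposition principle for pairs (exterior datum, solution). *)
Definition linear_problem : Prop :=
  forall (a : R) g1 g2 u1 u2,
    exterior_datum Omega g1 -> exterior_datum Omega g2 ->
    viscosity_solution g1 u1 -> viscosity_solution g2 u2 ->
    viscosity_solution (fun x => a * g1 x + g2 x)
                       (fun x => a * u1 x + u2 x).

End ViscositySolutions.

(* Main.v *)
(** A continuous function that agrees with a C^2 function in [Omega] and solves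
    the equation there classically is the unique viscosity solution for its own
    exterior values: a positive maximum of the difference with another solution
    would be attained in [Omega], and beyond [Omega] the difference vanishes, so
    that the tail of the integrals gives a strict inequality between the
    operators.

    The one-dimensional operator maps [|y| ^ (1 + 2s)], up to a divergent
    constant, to a positive multiple of [|y|] (by scaling; positivity is
    Clarkson's inequality).  Hence a suitable third difference [a] of
    [|y| ^ (1 + 2s)] is bounded, is C^2 because [1 + 2s > 2], and has a constant
    image [-kappa] near the origin.  For [u(x) = a(x_1) - a(x_0)] the line
    operator in the unit direction [z] is [kappa (|z_0| ^ 2s - |z_1| ^ 2s)] in
    [Omega], with extreme values [kappa] and [-kappa], attained only at the
    coordinate axes, and both operators vanish.  A small nonnegative bump placed
    far away near the diagonal of the [(x_0, x_1)]-plane only changes the line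
    operator in nearly diagonal directions, where it is well below [kappa], so
    adding the bump to [u] changes neither operator in [Omega].  The bump itself,
    which is the difference of the two solutions, is not a solution. *)
Require Import Defs.
From HB Require Import structures.
From mathcomp Require Import all_boot all_order all_algebra.
From mathcomp Require Import all_classical all_reals all_analysis.
From mathcomp Require Import measurable_realfun ring lra zify.

Set Implicit Arguments.
Unset Strict Implicit.
Unset Printing Implicit Defensive.

Import Order.TTheory GRing.Theory Num.Theory numFieldNormedType.Exports.

Local Open Scope classical_set_scope.
Local Open Scope ring_scope.

(** Neither operator is additive, and its value at a point involves every direction, so an explicit
    solution has to be controlled in all directions at once. A constant image of the profile
    achieves this: throughout Omega the line operator of the saddle depends on [z] alone, and the
    max-min values become a matter of counting dimensions. Three differences suit the range 2 < 1 +
    2s < 3. The second derivative of |y|^(1 + 2s) is a multiple of |y|^(2s - 1), Hoelder of exponent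
    below 1, so one difference makes it bounded; each of the other two differences absorbs one
    derivative. On the image side the steps [r], [3 * r], [3 * r] are chosen so that the third
    difference of |y| is flat on an interval of length [2 * r]. Thus 1/2 < s makes the saddle an
    admissible test function. The bound s < 1 makes the kernel integrable against t^2 at the origin
    and gives 2^(-2s) >= 1/4, which measures how far below [kappa] the line operator stays in the
    directions that reach the bump. Every comparison of operators is made under one integral over
    the positive half-line, pointwise in [t]; hence the early work on the symmetric form of the
    principal value. *)

(** * Upper and lower bounds for second differences of |x|^p *)

Section PowerInequalities.
Context {R : realType}.
Implicit Types (a t x p q r : R).

(** Young's inequality for the product of a^q and 1, with conjugate exponents 1/q and 1/(1 - q). *)
Lemma powR_bernoulli a q : 0 <= a -> 0 < q < 1 -> a `^ q <= 1 + q * (a - 1).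
Proof.
move=> a0 /andP[q0 q1].
have q'0 : 0 < 1 - q by rewrite subr_gt0.
have := @conjugate_powR R (a `^ q) 1 q^-1 (1 - q)^-1.
rewrite powR_ge0 ler01 !invr_gt0 q0 q'0 !invrK -powRrM divff ?gt_eqF//.
rewrite powRr1// powR1 mulr1 => /(_ isT isT isT isT).
by rewrite addrC subrK => /(_ erefl); lra.
Qed.

(** Split c^r as c * c^(r - 1) and enlarge the second factor to (a + b)^(r - 1), for c = a and c =
    b. *)
Lemma powR_superadditive a b r : 0 <= a -> 0 <= b -> 1 <= r ->
  a `^ r + b `^ r <= (a + b) `^ r.
Proof.
move=> a0 b0 r1.
have r0 : 0 < r by lra.
have h c d : 0 <= c -> 0 <= d -> c `^ r <= c * (c + d) `^ (r - 1).
  move=> c0 d0; rewrite -(mulr_powRB1 c0 r0) ler_wpM2l//.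
  by apply: ge0_ler_powR; rewrite ?subr_ge0 ?nnegrE ?addr_ge0// lerDl.
rewrite -(mulr_powRB1 (addr_ge0 a0 b0) r0) mulrDl lerD ?h//.
by rewrite [a + b]addrC h.
Qed.

Lemma powR_mean a b r : 0 <= a -> 0 <= b -> 1 <= r ->
  2 * ((a + b) / 2) `^ r <= a `^ r + b `^ r.
Proof.
move=> a0 b0 r1.
have h01 : 0 <= 2^-1 :> R by rewrite invr_ge0.
have h11 : (2^-1 : R) <= 1 by rewrite invf_le1// ler1n.
pose t : {i01 R} := Itv01 h01 h11.
have := @convex_powR R r r1 t a b.
rewrite !inE /= !in_itv /= !andbT => /(_ a0 b0).
rewrite convRE [X in X `^ _ <= _]convRE /= /unstable.onem /=.
have -> : 1 - 2^-1 = 2^-1 :> R by lra.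
rewrite -!mulrDr [2^-1 * (a + b)]mulrC => h.
by lra.
Qed.

Lemma sqr_powR_half x p : `|x| `^ p = (x ^+ 2) `^ (p / 2).
Proof.
rewrite -real_normK ?num_real// -powR_mulrn// -powRrM.
by congr (_ `^ _); field.
Qed.

(** The squares of 1 + t and 1 - t have mean 1 + t^2. Convexity of the power p/2 bounds the
    right-hand side below by 2 (1 + t^2)^(p/2), and superadditivity splits this power. *)
Lemma clarkson_le p t : 2 <= p -> 0 <= t ->
  2 + 2 * t `^ p <= `|1 + t| `^ p + `|1 - t| `^ p.
Proof.
move=> p2 t0; rewrite !sqr_powR_half.
have p2' : 1 <= p / 2 by lra.
have := powR_mean (sqr_ge0 (1 + t)) (sqr_ge0 (1 - t)) p2'.
have -> : ((1 + t) ^+ 2 + (1 - t) ^+ 2) / 2 = 1 + t ^+ 2 by field.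
have := powR_superadditive ler01 (sqr_ge0 t) p2'.
rewrite powR1 -(sqr_powR_half t) (ger0_norm t0); lra.
Qed.

(** A quantitative form of Clarkson's inequality, from which the strict positivity of
    [clarkson_constant] comes. After the same convexity step, (1 + t^2)^(p/2) is the product of 1 +
    t^2 and (1 + t^2)^(p/2 - 1); the last factor is at least 2^(p/2 - 1) against the summand 1 and
    at least (t^2)^(p/2 - 1) against t^2. *)
Lemma clarkson_gap_ge1 p t : 2 < p -> 1 <= t ->
  2 * (2 `^ (p / 2 - 1) - 1) <= `|1 + t| `^ p + `|1 - t| `^ p - 2 - 2 * t `^ p.
Proof.
move=> p2 t1; rewrite !sqr_powR_half.
have p2' : 1 <= p / 2 by lra.
have p0' : 0 < p / 2 by lra.
have := powR_mean (sqr_ge0 (1 + t)) (sqr_ge0 (1 - t)) p2'.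
have -> : ((1 + t) ^+ 2 + (1 - t) ^+ 2) / 2 = 1 + t ^+ 2 by field.
have t0 : 0 <= t by lra.
have t21 : 1 <= t ^+ 2 by rewrite expr_ge1.
have h0 : 0 <= 1 + t ^+ 2 by lra.
have -> : t `^ p = (t ^+ 2) `^ (p / 2) by rewrite -sqr_powR_half ger0_norm.
rewrite -(mulr_powRB1 h0 p0') -(mulr_powRB1 (sqr_ge0 t) p0').
have : 2 `^ (p / 2 - 1) <= (1 + t ^+ 2) `^ (p / 2 - 1).
  by apply: ge0_ler_powR; rewrite ?nnegrE; lra.
have : (t ^+ 2) `^ (p / 2 - 1) <= (1 + t ^+ 2) `^ (p / 2 - 1).
  by apply: ge0_ler_powR; rewrite ?nnegrE; lra.
move: (_ `^ _) (_ `^ _) (_ `^ _) => A B C.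
nra.
Qed.

(** Write |x|^p as x^2 times x^(p - 2) and apply Bernoulli to the second factor. The odd terms
    cancel and 2 + (2 + 4 (p - 2)) t^2 remains, which gives the constant 6. *)
Lemma second_difference_powR_le1 p t : 2 < p < 3 -> 0 <= t <= 1 ->
  `|1 + t| `^ p + `|1 - t| `^ p <= 2 + 6 * t ^+ 2.
Proof.
move=> /andP[p2 p3] /andP[t0 t1].
have q01 : 0 < p - 2 < 1 by lra.
have h x : 0 <= x -> `|x| `^ p <= x ^+ 2 * (1 + (p - 2) * (x - 1)).
  move=> x0; rewrite ger0_norm//.
  have -> : x `^ p = x ^+ 2 * x `^ (p - 2).
    have [->|xn0] := eqVneq x 0; first by rewrite powR0 ?expr0n ?mul0r//; lra.
    rewrite -powR_mulrn// -powRD ?xn0 ?implybT//.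
    by congr (_ `^ _); lra.
  by rewrite ler_wpM2l ?sqr_ge0// powR_bernoulli.
have h1 := h (1 + t) ltac:(lra).
have h2 := h (1 - t) ltac:(lra).
nra.
Qed.

(** By homogeneity this is the previous bound at 1/t, multiplied by t^p. *)
Lemma second_difference_powR_ge1 p t : 2 < p < 3 -> 1 <= t ->
  `|1 + t| `^ p + `|1 - t| `^ p <= 2 * t `^ p + 6 * t `^ (p - 2).
Proof.
move=> hp t1; have t0 : 0 < t by lra.
have h : 0 <= t^-1 <= 1 by rewrite invr_ge0 ltW//= invf_le1.
have := second_difference_powR_le1 hp h.
rewrite -(ler_pM2r (powR_gt0 p t0)).
have e x : `|x| `^ p * t `^ p = `|x * t| `^ p.
  by rewrite normrM (ger0_norm (ltW t0)) powRM// ltW.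
rewrite mulrDl !e (mulrDl 1) (mulrBl t 1) !mul1r mulVf ?gt_eqF//.
rewrite distrC [t + 1]addrC => /le_trans; apply.
have -> : t `^ (p - 2) = t^-1 ^+ 2 * t `^ p.
  rewrite powRB; last by rewrite (gt_eqF t0) implybT.
  by rewrite (powR_mulrn 2 (ltW t0)) exprVn mulrC.
by rewrite le_eqVlt; apply/orP; left; apply/eqP; ring.
Qed.

End PowerInequalities.

(** * Dilations and the reflection of the line *)

Section LebesgueChangeOfVariable.
Context {R : realType}.
Local Notation mu := (@lebesgue_measure R).
Local Open Scope ereal_scope.

(** Uniqueness of Lebesgue measure: the rescaled pushforward gives every half-open interval its
    length. *)
Lemma lebesgue_measure_scale (c : R) (A : set R) : (0 < c)%R ->
  measurable A ->
  mu A = c%:E * mu ((fun x => c * x)%R @^-1` A).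
Proof.
move=> c0 mA.
have mc : measurable_fun [set: measurableTypeR R]
    ((fun x : R => c * x)%R : measurableTypeR R -> measurableTypeR R).
  by apply: continuous_measurable_fun; exact: mulrl_continuous.
have c00 := ltW c0.
pose nu : {measure set (measurableTypeR R) -> \bar R} :=
  mscale (NngNum c00)
    (@pushforward _ _ (measurableTypeR R) (measurableTypeR R) R mu
       (fun x => c * x)%R).
rewrite (@lebesgue_measure_unique R (nu mc))// => _ [[a b]] _ <-.
rewrite /nu /mscale /pushforward /=.
rewrite [X in _ = _ * mu X](_ : _ = `](a / c)%R, (b / c)%R]%classic);
  last first.
  apply/seteqP; split => x /=; rewrite !in_itv/= ler_pdivlMr// ltr_pdivrMr//;
    by rewrite mulrC.
rewrite !lebesgue_measure_itv/= !lte_fin ltr_pM2r ?invr_gt0//.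
case: ifPn => _; last by rewrite mule0.
by rewrite -!EFinB -EFinM -mulrBl mulrC divfK// gt_eqF.
Qed.

Lemma ge0_integral_scale (c : R) (f : R -> \bar R) : (0 < c)%R ->
  measurable_fun [set: R] f -> (forall x, 0 <= f x) ->
  \int[mu]_(x in `]0%R, +oo[) f x =
  c%:E * \int[mu]_(x in `]0%R, +oo[) f (c * x)%R.
Proof.
move=> c0 mf f0.
have mc : measurable_fun [set: measurableTypeR R]
    ((fun x : R => c * x)%R : measurableTypeR R -> measurableTypeR R).
  exact: mulrl_measurable.
have c00 := ltW c0.
have -> : `]0%R, +oo[%classic =
    (fun x : measurableTypeR R => c * x : measurableTypeR R)%R @^-1` `]0%R, +oo[.
  by apply/seteqP; split => x /=; rewrite !in_itv/= !andbT pmulr_rgt0.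
rewrite -(@ge0_integral_pushforward _ _ _ _ _ _ mc)//; last first.
  exact: measurable_funTS.
rewrite -[c]/((NngNum c00)%:num) -ge0_integral_mscale//; last first.
  exact: measurable_funTS.
rewrite (_ : _ @^-1` _ = `]0%R, +oo[%classic); last first.
  by apply/seteqP; split => x /=; rewrite !in_itv/= !andbT pmulr_rgt0.
apply: eq_measure_integral => A mA _.
exact: lebesgue_measure_scale.
Qed.

Lemma Rintegral_oppr (D : set R) (f : R -> R) : measurable D ->
  measurable_fun [set: R] f ->
  mu.-integrable D (EFin \o (f \o -%R)%R) ->
  (mu.-integrable (-%R @^-1` D) (EFin \o f)
  /\ \int[mu]_(x in -%R @^-1` D) f x = \int[mu]_(x in D) f (- x))%R.
Proof.
move=> mD mf fi.
have mN : measurable_fun [set: measurableTypeR R]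
    ((fun x : R => - x)%R : measurableTypeR R -> measurableTypeR R).
  exact: oppr_measurable.
have mD' : measurable ((-%R : measurableTypeR R -> measurableTypeR R) @^-1` D).
  by rewrite -[X in measurable X]setTI; exact: mN.
have DE : (-%R : R -> R) @^-1` (-%R @^-1` D) = D.
  by apply/seteqP; split => x /=; rewrite opprK.
have mfE : measurable_fun [set: R] (EFin \o f) by exact/measurable_EFinP.
have fi' : mu.-integrable ((-%R : R -> R) @^-1` (-%R @^-1` D))
    ((EFin \o f) \o -%R) by rewrite DE.
split.
  have := @integrable_pushforward _ _ _ _ _ _ mN mu _ (EFin \o f) mfE fi' mD'.
  move=> /integrableP[_ fo]; apply/integrableP; split; first exact: measurable_funTS.
  move: fo; congr (_ < _); apply: eq_measure_integral => A mA _.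
  exact: lebesgue_measureN.
congr fine.
have := @integral_pushforward _ _ _ _ _ _ mN mu _ (EFin \o f) mfE fi' mD'.
rewrite DE => <-; apply: eq_measure_integral => A mA _.
exact/esym/lebesgue_measureN.
Qed.

End LebesgueChangeOfVariable.

(** * Integrability of powers at the origin and at infinity *)

Section PowerIntegrability.
Context {R : realType}.
Local Notation mu := (@lebesgue_measure R).
Implicit Types (a t q r : R).

Lemma powR_continuous_at r x : 0 < x -> {for x, continuous (@powR R ^~ r)}.
Proof.
move=> x0; apply: differentiable_continuous; apply/derivable1_diffP.
by apply: derivable_powR; rewrite in_itv/= x0.
Qed.

Lemma measurable_inv_powR q : measurable_fun [set: R] (fun t => (t `^ q)^-1).
Proof.
rewrite (_ : (fun t => _) = @powR R ^~ (- q)); first exact: measurable_powR.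
by apply/funext => t; rewrite powRN.
Qed.

Lemma integrable_powR0 r : -1 < r ->
  mu.-integrable `]0, 1] (EFin \o (@powR R ^~ r)).
Proof.
move=> r1; have r0 : 0 < r + 1 by lra.
have mf D : measurable D -> measurable_fun D (EFin \o (@powR R ^~ r)).
  move=> mD; apply/measurable_EFinP/measurable_funTS.
  exact: measurable_powR.
apply/integrableP; split; first exact: mf.
under eq_integral do rewrite /= ger0_norm ?powR_ge0//.
(* The power may blow up at 0, so the fundamental theorem of calculus is applied on closed intervals
   that exhaust []0, 1]]; the integrals stay below 1/(r + 1), and monotone convergence concludes. *)
pose F n : set (measurableTypeR R) := `[n.+1%:R^-1, 1]%classic.
have FE : `]0, 1]%classic = \bigcup_n F n.
  apply/seteqP; split => [x|x [n _]]; rewrite /F /= !in_itv/=.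
    move=> /andP[x0 x1]; exists (Num.truncn x^-1) => //.
    rewrite /= in_itv/= x1 andbT invf_ple ?posrE//.
    exact/ltW/truncnS_gt.
  move=> /andP[nx ->]; rewrite andbT; apply: lt_le_trans nx.
  by rewrite invr_gt0.
have nF : nondecreasing_seq F.
  move=> m n mn; apply/subsetPset => x; rewrite /F /= !in_itv/= => /andP[mx ->].
  rewrite andbT; apply: le_trans mx.
  by rewrite lef_pV2 ?posrE// ler_nat.
have mF i : measurable (F i) by exact: measurable_itv.
have := @ge0_nondecreasing_set_cvg_integral _ _ _ F _
  (mu : {measure set (measurableTypeR R) -> \bar R}) nF mF
  (fun i => mf _ (mF i)).
rewrite -FE => /(_ _)/cvg_lim <-//; last first.
  by move=> i x _; rewrite lee_fin powR_ge0.
apply: (@le_lt_trans _ _ ((r + 1)^-1)%:E); last exact: ltry.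
apply: lime_le.
  apply: ereal_nondecreasing_is_cvgn.
  apply: ge0_nondecreasing_set_nondecreasing_integral => //.
    by move=> i; apply: mf; exact: mF.
  by move=> i x _; rewrite lee_fin powR_ge0.
near=> n; rewrite /F.
have n0 : 0 < n.+1%:R^-1 :> R by rewrite invr_gt0.
have n1 : n.+1%:R^-1 < 1 :> R.
  rewrite invf_lt1// ltr1n ltnS; near: n; exact: nbhs_infty_gt.
have cF (x s : R) : 0 < x -> {for x, continuous (@powR R ^~ s : R -> R)}.
  exact: powR_continuous_at.
have dF (x : R) : 0 < x ->
    is_derive x 1 (fun t => (r + 1)^-1 * t `^ (r + 1)) (x `^ r).
  move=> x0; have h := is_derive1_powR (r + 1) x0.
  have := @is_deriveZ _ _ _ _ (r + 1)^-1 x 1 _ h.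
  by rewrite /GRing.scale/= addrK mulrA mulVf ?mul1r// gt_eqF.
rewrite (@continuous_FTC2 _ _ (fun t => (r + 1)^-1 * t `^ (r + 1)))//.
- rewrite powR1 mulr1 -EFinB lee_fin gerBl mulr_ge0 ?powR_ge0//.
  by rewrite invr_ge0 ltW.
- apply/continuous_within_itvP => //; split.
  + by move=> x /=; rewrite in_itv/= => /andP[nx _]; apply: cF; exact: lt_trans nx.
  + by apply: cvg_at_right_filter; exact: cF.
  + by apply: cvg_at_left_filter; apply: cF; lra.
- split.
  + move=> x; rewrite in_itv/= => /andP[nx _]; apply: ex_derive; apply: dF.
    exact: lt_trans nx.
  + by apply: cvg_at_right_filter; apply: cvgMl_tmp; exact: cF.
  + by apply: cvg_at_left_filter; apply: cvgMl_tmp; apply: cF; lra.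
- move=> x; rewrite in_itv/= => /andP[nx _].
  have x0 : 0 < x by exact: lt_trans nx.
  by have [_] := dF _ x0; rewrite derive1E.
Unshelve. all: by end_near. Qed.

Lemma integrable_powRy :
  mu.-integrable `[1, +oo[ (EFin \o (@powR R ^~ (- 2))).
Proof.
have mf : measurable_fun (`[1%R, +oo[%classic : set R) (@powR R ^~ (-2)).
  by apply: measurable_funTS; exact: measurable_powR.
have fE (x : R) : 0 < x -> x `^ (- 2) = x ^- 2.
  by move=> x0; rewrite (powR_invn 2 (ltW x0)).
apply/integrableP; split; first exact/measurable_EFinP.
under eq_integral do rewrite /= ger0_norm ?powR_ge0//.
rewrite (@ge0_continuous_FTC2y _ (@powR R ^~ (-2)) (fun t => - t^-1) 1 0).
- by rewrite -EFinB ltry.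
- by move=> *; exact: powR_ge0.
- apply/continuous_within_itvcyP; split.
    by move=> x; rewrite in_itv/= andbT => x1; apply: powR_continuous_at; lra.
  by apply: cvg_at_right_filter; exact: powR_continuous_at.
- rewrite -oppr0; apply: cvgN; apply/(@gtr0_cvgV0 _ _ _ _ id).
    exact: nbhs_pinfty_gt.
  exact: cvg_id.
- move=> x x1; apply: derivableN; apply: derivableV => //; lra.
- by apply: cvg_at_right_filter; apply: cvgN; apply: cvgV.
- move=> x; rewrite in_itv/= andbT => x1; rewrite derive1E.
  have x0 : x != 0 by lra.
  rewrite deriveN; last exact: derivableV.
  rewrite deriveV// derive_id /GRing.scale/= mulr1 opprK fE//; lra.
Qed.

(* [t ^ 2 / t ^ p] near 0 and [t ^ -2] at infinity. *)
Definition majorant (p t : R) : R :=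
  if t <= 1 then t `^ (2 - p) else t `^ (- 2).

Lemma integrable_majorant p : p < 3 ->
  mu.-integrable `]0, +oo[ (EFin \o majorant p).
Proof.
move=> p3.
have mm : measurable_fun [set: R] (majorant p).
  apply: measurable_fun_ifT; [|exact: measurable_powR..].
  exact: measurable_fun_ler.
rewrite (_ : `]0, +oo[%classic = `]0, 1]%classic `|` `]1, +oo[%classic); last first.
  by rewrite -itv_bndbnd_setU//= bnd_simp.
have mmD D : measurable D -> measurable_fun D (EFin \o majorant p).
  by move=> mD; apply/measurable_EFinP/measurable_funTS.
apply/integrableP; split; first by apply: mmD; exact: measurableU.
rewrite ge0_integral_setU//=; last 2 first.
  apply/measurable_EFinP; apply: measurableT_comp => //.
  exact: measurable_funTS.
  apply/disj_setPS => x [/=]; rewrite !in_itv/= andbT => /andP[_ x1].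
  by rewrite ltNge x1.
apply: lte_add_pinfty.
  have /integrableP[_] := @integrable_powR0 (2 - p) ltac:(lra).
  congr (_ < _)%E; apply: eq_integral => x; rewrite inE/= in_itv/= => /andP[_ x1].
  by rewrite /majorant x1.
have /integrableP[_] := integrable_powRy.
apply: le_lt_trans.
rewrite [leLHS](_ : _ =
    (\int[mu]_(x in `]1%R, +oo[) (`|x `^ (-2)|)%:E)%E); last first.
  apply: eq_integral => x; rewrite inE/= in_itv/= andbT /majorant => x1.
  by rewrite leNgt x1.
apply: ge0_subset_integral => //=.
  apply/measurable_EFinP; apply: measurableT_comp => //.
  by apply: measurable_funTS; exact: measurable_powR.
by move=> x /=; rewrite !in_itv/= !andbT => /ltW.
Qed.

End PowerIntegrability.

(** * From the principal value to an integral over the positive half-line *)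

Section SymmetricForm.
Context {R : realType}.
Local Notation mu := (@lebesgue_measure R).
Implicit Types (f g h : R -> R) (D : set R).

(** The quotient is dominated by [C] times [majorant]. Growth of order t^(p - 2) is allowed because
    the second difference of |x|^p, even after its divergent part is removed, has that order;
    bounded functions are covered since p > 2. *)
Lemma integrable_kernel p C g : 2 < p < 3 -> measurable_fun [set: R] g ->
  (forall t, 0 < t <= 1 -> `|g t| <= C * t ^+ 2) ->
  (forall t, 1 <= t -> `|g t| <= C * t `^ (p - 2)) ->
  mu.-integrable `]0, +oo[ (EFin \o (fun t => g t / t `^ p)).
Proof.
move=> /andP[p2 p3] mg g0 g1.
have := @integrableZl _ _ _ mu `]0, +oo[%classic ltac:(by []) C _
  (integrable_majorant p3).
apply: le_integrable => //.
  apply/measurable_EFinP/measurable_funTS/measurable_funM => //.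
  exact: measurable_inv_powR.
move=> t; rewrite /= in_itv/= andbT => t0.
have tp : 0 <= t `^ (- p) by exact: powR_ge0.
rewrite lee_fin -powRN normrM (ger0_norm tp).
apply: le_trans (ler_norm _); rewrite /majorant; case: ifPn => [t1|].
  apply: le_trans (ler_wpM2r tp (g0 t _)) _; first by rewrite t0.
  rewrite -mulrA -(powR_mulrn 2 (ltW t0)) -powRD//.
  by rewrite (gt_eqF t0) implybT.
rewrite -ltNge => t1.
apply: le_trans (ler_wpM2r tp (g1 t (ltW t1))) _.
rewrite -mulrA -powRD; last by rewrite (gt_eqF t0) implybT.
by rewrite (_ : p - 2 + - p = - 2)//; lra.
Qed.

(** Cutting [g] off below [d] creates the quadratic bound at 0, since 1 <= t^2 / d^2 on the rest.
    This covers one-sided quotients, which lack the cancellation needed at the origin. *)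
Lemma integrable_kernel_away p C d g : 2 < p < 3 -> 0 < d ->
  measurable_fun [set: R] g ->
  (forall t, d <= t -> `|g t| <= C) ->
  mu.-integrable `[d, +oo[ (EFin \o (fun t => g t / t `^ p)).
Proof.
move=> hp d0 mg gC; have [p2 p3] := andP hp.
pose K := `|C| + `|C| / d ^+ 2.
have d20 : 0 < d ^+ 2 by rewrite exprn_gt0.
have hK : 0 <= `|C| / d ^+ 2 by apply: divr_ge0 => //; exact: ltW.
have C0 := normr_ge0 C.
pose h t := if d <= t then g t else 0.
have mh : measurable_fun [set: R] h.
  by apply: measurable_fun_ifT => //; exact: measurable_fun_ler.
have hC t : `|h t| <= `|C|.
  rewrite /h; case: ifPn => dt; last by rewrite normr0.
  exact: le_trans (gC _ dt) (ler_norm _).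
have hi : mu.-integrable `]0, +oo[ (EFin \o (fun t => h t / t `^ p)).
  apply: (@integrable_kernel p K) => // t.
    move=> /andP[t0 t1]; have [dt|td] := leP d t; last first.
      rewrite /h (lt_geF td) normr0 mulr_ge0 ?sqr_ge0// /K; lra.
    apply: le_trans (hC t) _.
    apply: (@le_trans _ _ (`|C| / d ^+ 2 * t ^+ 2)).
      rewrite -mulrA ler_peMr// mulrC ler_pdivlMr// mul1r.
      by rewrite ler_sqr ?nnegrE ?(ltW t0) ?(ltW d0).
    by rewrite ler_wpM2r ?sqr_ge0// /K; lra.
  move=> t1; apply: le_trans (hC t) _.
  apply: (@le_trans _ _ (K * 1)); first by rewrite mulr1 /K; lra.
  apply: ler_wpM2l; first by rewrite /K; lra.
  have := ler_powR t1 (_ : 0 <= p - 2).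
  by rewrite powRr0; apply; rewrite subr_ge0 ltW.
have : mu.-integrable `[d, +oo[ (EFin \o (fun t => h t / t `^ p)).
  apply: integrableS hi => // t /=; rewrite !in_itv/= !andbT.
  exact: lt_le_trans.
apply: eq_integrable => // t; rewrite inE/= in_itv/= andbT => dt.
by rewrite /h dt.
Qed.

(** Once the integrand is symmetrized it is integrable up to 0, and the principal value limit is an
    ordinary integral. *)
Lemma Rintegral_cvg_at0 f d : 0 < d -> mu.-integrable `]0, d[ (EFin \o f) ->
  \int[mu]_(t in `]e, d[) f t @[e --> 0^'+] --> \int[mu]_(t in `]0, d[) f t.
Proof.
move=> d0 fi; pose h := f \_ `]0, d[.
have hi D : measurable D -> mu.-integrable D (EFin \o h).
  move=> mD; apply: (@integrableS _ _ _ _ setT) => //.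
  by rewrite -restrict_EFin; apply/integrable_restrict => //; rewrite setTI.
have h0 := @parameterized_integral_cvg_left _ 0 d h d0 (hi _ (measurable_itv _)).
have {h0}h0 : parameterized_integral mu 0 e h @[e --> 0^'+] --> 0.
  exact: cvg_at_right_filter.
rewrite -[X in _ --> X]subr0.
apply: (cvg_trans _ (cvgB (cvg_cst (\int[mu]_(t in `]0, d[) f t)) h0)).
apply: near_eq_cvg; near=> e; rewrite /parameterized_integral/=.
have e0 : 0 < e by [].
have ed : e < d by near: e; exact: nbhs_right_lt.
rewrite !fctE.
have -> : \int[mu]_(t in `[0, e]) h t = \int[mu]_(t in `]0, e]) f t.
  rewrite -Rintegral_mkcondr; congr (Rintegral _ _ _).
  apply/seteqP; split=> t /=; rewrite !in_itv/=.
    by move=> [/andP[_ ->] /andP[->]].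
  by move=> /andP[t0 te]; rewrite te ltW// t0 (le_lt_trans te).
by rewrite Rintegral_itvB// bnd_simp// ltW.
Unshelve. all: by end_near. Qed.

Lemma Rintegral_symmetrize D f : measurable D -> D `<=` `]0, +oo[ ->
  measurable_fun [set: R] f ->
  mu.-integrable D (EFin \o f) -> mu.-integrable D (EFin \o (f \o -%R)) ->
  \int[mu]_(t in D `|` -%R @^-1` D) f t = \int[mu]_(t in D) (f t + f (- t)).
Proof.
move=> mD D0 mf fi fNi.
have [fi' fE] := Rintegral_oppr mD mf fNi.
have mND : measurable ((-%R : R -> R) @^-1` D).
  by rewrite -[X in measurable X]setTI; exact: oppr_measurable.
rewrite RintegralD// Rintegral_setU//= ?fE//.
  apply/integrableP; split; first exact/measurable_EFinP/measurable_funTS.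
  rewrite ge0_integral_setU//=; last 2 first.
  - apply/measurable_EFinP; apply: measurableT_comp => //.
    exact: measurable_funTS.
  - apply/disj_setPS => t [/D0 /=]; rewrite in_itv/= andbT => t0 /D0/=.
    by rewrite in_itv/= andbT oppr_gt0 => /lt_trans -/(_ _ t0); rewrite ltxx.
  apply: lte_add_pinfty; first by case/integrableP: fi.
  by case/integrableP: fi'.
apply/disj_setPS => t [/D0 /=]; rewrite in_itv/= andbT => t0 /D0/=.
by rewrite in_itv/= andbT oppr_gt0 => /lt_trans -/(_ _ t0); rewrite ltxx.
Qed.

End SymmetricForm.

(** * The directional operator as one absolutely convergent integral *)

Section DirectionalOperator.
Context {R : realType} {N : nat}.
Local Notation mu := (@lebesgue_measure R).
Variable s : R.
Hypothesis hs : 2^-1 < s < 1.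
Implicit Types (x z : 'rV[R]_N) (w phi : 'rV[R]_N -> R) (t delta C : R).

Definition second_diff w x z t : R := w (x + t *: z) + w (x - t *: z) - 2 * w x.

(** The test function below [delta] and [w] beyond it: the two parts of [E_dir] merge into one
    integrand, and operators with different [delta] can be compared pointwise. *)
Definition spliced_diff delta w phi x z t : R :=
  if t < delta then second_diff phi x z t else second_diff w x z t.

Definition line_measurable w x z :=
  measurable_fun [set: R] (fun t => w (x + t *: z)).

Lemma measurable_second_diff w x z :
  line_measurable w x z -> measurable_fun [set: R] (second_diff w x z).
Proof.
move=> mw; apply: measurable_funB => //; apply: measurable_funD => //.
have -> : (fun t => w (x - t *: z)) = (fun t => w (x + t *: z)) \o -%R.
  by apply/funext => t /=; rewrite scaleNr.
by apply: measurableT_comp => //; exact: oppr_measurable.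
Qed.

(** Folding [t] and [- t] together cancels the first-order part. The second difference of [phi] is
    O(t^2) near 0 and that of [w] is bounded, so the folded integrand is integrable over the
    half-line. *)
Lemma E_dirE delta w phi x z C : 0 < delta ->
  line_measurable phi x z -> line_measurable w x z ->
  (forall t, `|t| < delta -> `|phi (x + t *: z)| <= C) ->
  (forall t, 0 < t < delta -> `|second_diff phi x z t| <= C * t ^+ 2) ->
  (forall t, `|w (x + t *: z)| <= C) ->
  mu.-integrable `]0, +oo[
    (EFin \o (fun t => spliced_diff delta w phi x z t / t `^ (1 + 2 * s))) /\
  E_dir s z delta w phi x =
  \int[mu]_(t in `]0, +oo[) (spliced_diff delta w phi x z t / t `^ (1 + 2 * s)).
Proof.
move=> d0 mphi mw bphi dphi bw.
pose p := 1 + 2 * s; rewrite -/p.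
have hp : 2 < p < 3 by rewrite /p; move/andP: hs => [s1 s2]; apply/andP; lra.
have [p2 p3] := andP hp.
have C0 : 0 <= C by apply: le_trans (bw 0).
have bsd v t : `|v (x + t *: z)| <= C -> `|v (x + (- t) *: z)| <= C ->
    `|v x| <= C -> `|second_diff v x z t| <= 4 * C.
  rewrite /second_diff scaleNr => h1 h2 h3.
  by rewrite !ler_norml in h1 h2 h3 *; lra.
have mG : measurable_fun [set: R] (spliced_diff delta w phi x z).
  apply: measurable_fun_ifT; [|exact: measurable_second_diff..].
  exact: measurable_fun_ltr.
have phix : `|phi x| <= C.
  by have := bphi 0; rewrite scale0r addr0 normr0; exact.
have wx : `|w x| <= C by have := bw 0; rewrite scale0r addr0.
pose K := C + 4 * C + 4 * C / delta ^+ 2.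
have d20 : 0 < delta ^+ 2 by rewrite exprn_gt0.
have hK : 0 <= 4 * C / delta ^+ 2 by apply: divr_ge0; [lra|exact: ltW].
have Gi : mu.-integrable `]0, +oo[
    (EFin \o (fun t => spliced_diff delta w phi x z t / t `^ p)).
  apply: (@integrable_kernel _ p K) => // t; rewrite /spliced_diff.
    move=> /andP[t0 t1]; case: ifPn => td.
      apply: le_trans (dphi t _) _; first by rewrite t0.
      by rewrite ler_wpM2r ?sqr_ge0// /K; lra.
    apply: le_trans (bsd _ _ (bw _) (bw _) wx) _.
    apply: (@le_trans _ _ (4 * C / delta ^+ 2 * t ^+ 2)).
      rewrite -mulrA ler_peMr ?mulr_ge0// mulrC ler_pdivlMr// mul1r.
      by rewrite ler_sqr ?nnegrE ?(ltW t0) ?(ltW d0)// leNgt.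
    by rewrite ler_wpM2r ?sqr_ge0// /K; lra.
  move=> t1; have t0 : 0 < t by lra.
  apply: (@le_trans _ _ (K * 1)); last first.
    rewrite ler_wpM2l//; first by rewrite /K; lra.
    have := ler_powR t1 (_ : 0 <= p - 2).
  by rewrite powRr0; apply; rewrite subr_ge0 ltW.
  apply: (@le_trans _ _ (4 * C)); last by rewrite mulr1 /K; lra.
  case: ifPn => td; last exact: bsd.
  apply: bsd => //; apply: bphi; rewrite ?normrN gtr0_norm//.
split => //; rewrite /E_dir.
pose q v := kernel_quotient s v x z.
have qE v t : 0 < t -> q v t + q v (- t) = second_diff v x z t / t `^ p.
  move=> t0; rewrite /q /kernel_quotient -/p normrN gtr0_norm// -mulrDl.
  by rewrite /second_diff scaleNr; congr (_ / _); lra.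
have mq v : line_measurable v x z -> measurable_fun [set: R] (q v).
  move=> mv; apply: measurable_funM; first exact: measurable_funB.
  rewrite (_ : (fun t => _) = (@powR R ^~ (- p)) \o (fun t : R => `|t|)).
    by apply: measurableT_comp => //; exact: measurable_powR.
  by apply/funext => t/=; rewrite powRN.
have nearE e : 0 < e ->
    \int[mu]_(t in [set t | e < `|t| < delta]) q phi t =
    \int[mu]_(t in `]e, delta[) (spliced_diff delta w phi x z t / t `^ p).
  move=> e0.
  rewrite (_ : [set t | e < `|t| < delta] =
      `]e, delta[%classic `|` -%R @^-1` `]e, delta[%classic); last first.
    apply/seteqP; split=> t /=; rewrite !in_itv/=.
      have [t0|t0] := leP 0 t; first by rewrite ger0_norm//; left.
      by rewrite ltr0_norm//; right.
    move=> [] /andP[h1 h2]; first by rewrite gtr0_norm ?h1//; apply: lt_trans h1.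
    by rewrite -normrN gtr0_norm ?h1//; apply: lt_trans h1.
  (* The two one-sided quotients are integrable separately only away from 0; their sum alone
     survives the passage e -> 0. *)
  have ei (v : R -> R) : measurable_fun [set: R] v ->
      (forall t, `|t| < delta -> `|v t| <= C) ->
      mu.-integrable `]e, delta[ (EFin \o (fun t => (v t - phi x) / t `^ p)).
    move=> mv vC.
    have : mu.-integrable `[e, +oo[
        (EFin \o (fun t => (if t < delta then v t - phi x else 0) / t `^ p)).
      apply: (@integrable_kernel_away _ p (2 * C)) => //.
        apply: measurable_fun_ifT => //; first exact: measurable_fun_ltr.
        exact: measurable_funB.
      move=> t et; case: ifPn => td; last by rewrite normr0; lra.
      have := vC t; rewrite ger0_norm ?(le_trans _ et) ?(ltW e0)// => /(_ td).
      by move: phix; rewrite !ler_norml => /[swap]; lra.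
    set k := EFin \o _ => ki.
    have {}ki : mu.-integrable `]e, delta[ k.
      apply: (integrableS _ _ _ ki) => //.
      by move=> t /=; rewrite !in_itv/= andbT => /andP[/ltW].
    apply: eq_integrable ki => //.
    by move=> t; rewrite inE/= in_itv/= /k/= => /andP[_ ->].
  rewrite Rintegral_symmetrize//.
  - apply: eq_Rintegral => t; rewrite inE/= in_itv/= => /andP[et td].
    by rewrite qE ?(lt_trans e0)// /spliced_diff td.
  - by move=> t /=; rewrite !in_itv/= !andbT => /andP[et _]; exact: lt_trans et.
  - exact: mq.
  - apply: eq_integrable (ei _ mphi bphi) => // t; rewrite inE/= in_itv/=.
    by move=> /andP[et _]; rewrite /q /kernel_quotient gtr0_norm// (lt_trans e0).
  - have mphiN : measurable_fun [set: R] (fun t => phi (x + (- t) *: z)).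
      by apply: (measurableT_comp mphi); exact: oppr_measurable.
    have bphiN t : `|t| < delta -> `|phi (x + (- t) *: z)| <= C.
      by move=> td; apply: bphi; rewrite normrN.
    apply: eq_integrable (ei _ mphiN bphiN) => // t; rewrite inE/= in_itv/=.
    move=> /andP[et _].
    by rewrite /q /kernel_quotient normrN gtr0_norm// (lt_trans e0).
have Gi0 : mu.-integrable `]0, delta[
    (EFin \o (fun t => spliced_diff delta w phi x z t / t `^ p)).
  by apply: integrableS Gi => // t /=; rewrite !in_itv/= andbT => /andP[].
(* The limit exists, so [lim] is a true limit here and not a default value. *)
rewrite (_ : lim _ = \int[mu]_(t in `]0, delta[)
    (spliced_diff delta w phi x z t / t `^ p)); last first.
  apply: cvg_lim => //; apply: cvg_trans (Rintegral_cvg_at0 d0 Gi0).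
  apply: near_eq_cvg; near=> e; rewrite -nearE//.
rewrite (_ : \int[mu]_(t in [set t | delta <= `|t|]) kernel_quotient s w x z t =
    \int[mu]_(t in `[delta, +oo[) (spliced_diff delta w phi x z t / t `^ p));
  last first.
  rewrite -/(q w).
  rewrite (_ : [set t | delta <= `|t|] =
      `[delta, +oo[%classic `|` -%R @^-1` `[delta, +oo[%classic); last first.
    apply/seteqP; split=> t /=; rewrite !in_itv/= !andbT ler_normr.
      by move=> /orP.
    by move=> [] ->; rewrite ?orbT.
  rewrite Rintegral_symmetrize//.
  - apply: eq_Rintegral => t; rewrite inE/= in_itv/= andbT => dt.
    by rewrite qE ?(lt_le_trans d0)// /spliced_diff ltNge dt.
  - by move=> t /=; rewrite !in_itv/= !andbT; exact: lt_le_trans.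
  - exact: mq.
  - have : mu.-integrable `[delta, +oo[
        (EFin \o (fun t => (w (x + t *: z) - w x) / t `^ p)).
      apply: (@integrable_kernel_away _ p (2 * C)) => //.
        exact: measurable_funB.
      move=> t _; have := bw t; rewrite !ler_norml in wx *.
      by move: wx => /[swap]; lra.
    apply: eq_integrable => // t; rewrite inE/= in_itv/= andbT => dt.
    by rewrite /q /kernel_quotient ger0_norm// ltW// (lt_le_trans d0).
  - have : mu.-integrable `[delta, +oo[
        (EFin \o (fun t => (w (x + (- t) *: z) - w x) / t `^ p)).
      apply: (@integrable_kernel_away _ p (2 * C)) => //.
        apply: measurable_funB => //.
        by apply: (measurableT_comp mw); exact: oppr_measurable.
      move=> t _; have := bw (- t); rewrite !ler_norml in wx *.
      by move: wx => /[swap]; lra.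
    apply: eq_integrable => // t; rewrite inE/= in_itv/= andbT => dt.
    by rewrite /q /kernel_quotient normrN ger0_norm// ltW// (lt_le_trans d0).
rewrite -Rintegral_setU//.
- by rewrite -itv_bndbnd_setU//= bnd_simp.
- by rewrite -itv_bndbnd_setU//= bnd_simp.
- apply/disj_setPS => t [/=]; rewrite !in_itv/= andbT => /andP[_ x1].
  by rewrite leNgt x1.
Unshelve. all: by end_near. Qed.

End DirectionalOperator.

(** * Local estimates for functions with continuous partial derivatives *)

Section SmoothFunctions.
Context {R : realType} {N : nat}.
Implicit Types (x y z h v : 'rV[R]_N) (phi : 'rV[R]_N -> R).

Lemma is_derive_line phi x v t : derivable phi (x + t *: v) v ->
  is_derive t 1 (fun r => phi (x + r *: v)) ('D_v phi (x + t *: v)).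
Proof.
have E : (fun h : R => h^-1 *:
      (((fun r => phi (x + r *: v)) \o shift t) (h *: (1 : R)) -
       phi (x + t *: v))) =
    (fun h : R => h^-1 *:
      ((phi \o shift (x + t *: v)) (h *: v) - phi (x + t *: v))).
  apply/funext => h /=; congr (_ *: (phi _ - _)).
  by rewrite (_ : h *: (1 : R) = h) ?scalerDl 1?addrCA//; exact: mulr1.
move=> dphi; split; rewrite /derivable ?/derive E//.
Qed.

Lemma MVT_line phi x v r : (forall y, derivable phi y v) ->
  exists2 c, `|c| <= `|r| & phi (x + r *: v) - phi x = r * 'D_v phi (x + c *: v).
Proof.
move=> dphi; pose g t := phi (x + t *: v).
have gD (t : R) : is_derive t 1 g ('D_v phi (x + t *: v)).
  exact: is_derive_line.
have gc a b : {within `[a, b], continuous g}.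
  apply: derivable_within_continuous => t _.
  exact: (@ex_derive _ _ _ _ _ _ _ (gD t)).
have g0 : g 0 = phi x by rewrite /g scale0r addr0.
have [r0|r0] := leP 0 r.
  have [c cr gE] := MVT_segment r0 (fun t _ => gD t) (gc _ _).
  exists c; last by rewrite -g0 gE subr0 mulrC.
  by move: cr; rewrite in_itv/= => /andP[c0 cr]; rewrite !ger0_norm.
have [c cr gE] := MVT_segment (ltW r0) (fun t _ => gD t) (gc _ _).
exists c; last by rewrite -g0 -opprB gE sub0r mulrN opprK mulrC.
move: cr; rewrite in_itv/= => /andP[rc c0].
by rewrite (ltr0_norm r0) ler0_norm// lerN2.
Qed.

Lemma coord_le_norm x i : `|x 0 i| <= `|x|.
Proof.
rewrite [leRHS]/Num.norm/= mx_normrE; apply/bigmax_geP; right => /=.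
by exists (0, i).
Qed.

Lemma norm_le_coord x (r : R) : 0 <= r -> (forall i, `|x 0 i| <= r) -> `|x| <= r.
Proof.
move=> r0 xr; rewrite [leLHS]/Num.norm/= mx_normrE; apply/bigmax_leP; split => //.
by move=> [i j] _ /=; rewrite ord1.
Qed.

(* Move from [x] to [y] one coordinate at a time. *)
Lemma MVT_coordinates phi x y :
  (forall i y, derivable phi y (delta_mx 0 i)) ->
  exists2 xi : 'I_N -> 'rV[R]_N,
    forall i, `|xi i - x| <= `|y - x| &
    phi y - phi x = \sum_i (y 0 i - x 0 i) * 'D_(delta_mx 0 i) phi (xi i).
Proof.
move=> dphi.
pose P k : 'rV[R]_N := \row_j (if (j < k)%N then y 0 j else x 0 j).
have PS (k : 'I_N) : P k.+1 = P k + (y 0 k - x 0 k) *: delta_mx 0 k.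
  apply/rowP => j; rewrite !mxE/= ltnS leq_eqVlt -val_eqE/=.
  case: (eqVneq (j : nat) k) => [/val_inj->|_] /=; last by rewrite mulr0 addr0.
  by rewrite ltnn mulr1 addrC subrK.
have /choice[c cE] (k : 'I_N) : exists c : R, `|c| <= `|y 0 k - x 0 k| /\
    phi (P k.+1) - phi (P k) =
    (y 0 k - x 0 k) * 'D_(delta_mx 0 k) phi (P k + c *: delta_mx 0 k).
  have [c c1 c2] := MVT_line (P k) (y 0 k - x 0 k) (dphi k).
  by exists c; split => //; rewrite PS.
exists (fun k : 'I_N => P k + c k *: delta_mx 0 k).
  move=> i; have [ci _] := cE i.
  apply: norm_le_coord => // j; rewrite !mxE/= -val_eqE/=.
  case: (eqVneq (j : nat) i) => [/val_inj->|_] /=.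
    rewrite ltnn mulr1 addrAC subrr add0r (le_trans ci)//.
    by have := coord_le_norm (y - x) i; rewrite !mxE.
  rewrite mulr0 addr0; case: ifPn => _; last by rewrite subrr normr0.
  by have := coord_le_norm (y - x) j; rewrite !mxE.
rewrite -(eq_bigr _ (fun i _ => (cE i).2)).
rewrite -(big_mkord xpredT (fun k => phi (P k.+1) - phi (P k))) telescope_sumr//.
congr (phi _ - phi _); apply/rowP => j; rewrite !mxE ?ltn_ord//.
Qed.

Lemma continuous_bounded_ball (f : 'rV[R]_N -> R) x r : continuous f ->
  exists2 M, 0 <= M & forall y, `|y - x| <= r -> `|f y| <= M.
Proof.
move=> cf; have [r0|r0] := ltP r 0.
  by exists 0 => // y /le_lt_trans/(_ r0); rewrite ltNge normr_ge0.
pose A := [set y | `|y - x| <= r].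
have A0 : A !=set0 by exists x; rewrite /A/= subrr normr0.
have cA : compact A.
  apply: bounded_closed_compact.
    exists (r + `|x|); split; first exact: num_real.
    move=> M rM y Ay; apply/ltW; apply: le_lt_trans rM.
    by rewrite -[y](subrK x) (le_trans (ler_normD _ _))// lerD2r.
  have /continuous_closedP cA : continuous (fun y => `|y - x|).
    by move=> y; exact: (cvg_norm (cvgB (@cvg_id _ (nbhs y)) (cvg_cst x))).
  by have := cA [set t | t <= r]; apply; exact: closed_le.
have cnf : {within A, continuous (fun y => `|f y|)}.
  by apply: continuous_subspaceT => y; exact: (cvg_norm (cf y)).
have [c _ fc] := EVT_max_rV A0 cA cnf.
by exists `|f c| => // y Ay; apply: fc; rewrite inE.
Qed.

(** [C1] speaks of partial derivatives only, so the increment is taken along a path parallel to the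
    axes, which stays in the ball where compactness bounds the partials. *)
Lemma C1_lipschitz phi x r : C1 phi ->
  exists2 M, 0 <= M &
    forall y, `|y - x| <= r -> `|phi y - phi x| <= M * `|y - x|.
Proof.
move=> hphi; have dphi i : forall y, derivable phi y (delta_mx 0 i) := (hphi i).1.
have /choice[M hM] (i : 'I_N) : exists M, 0 <= M /\
    forall y, `|y - x| <= r -> `|'D_(delta_mx 0 i) phi y| <= M.
  by have [M M0 h] := continuous_bounded_ball x r (hphi i).2; exists M.
exists (\sum_i M i); first by apply: sumr_ge0 => i _; exact: (hM i).1.
move=> y yr; have [xi xir ->] := MVT_coordinates x y dphi.
rewrite mulr_suml (le_trans (ler_norm_sum _ _ _))// ler_sum// => i _.
rewrite normrM mulrC ler_pM//.
  by apply: (hM i).2; exact: le_trans (xir i) yr.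
by have := coord_le_norm (y - x) i; rewrite !mxE.
Qed.

Lemma C1_continuous phi : C1 phi -> continuous phi.
Proof.
move=> hphi x; have [M M0 hM] := C1_lipschitz x 1 hphi.
apply/(@cvgrPdist_le _ _ _ (nbhs x)) => e e0.
have M1 : 0 < M + 1 by lra.
apply: (iffRL (nbhs_normP x _)); exists (Num.min 1 (e / (M + 1))) => /=.
  by rewrite lt_min ltr01 divr_gt0.
move=> y /=; rewrite lt_min distrC => /andP[/ltW y1 /ltW ye].
rewrite distrC (le_trans (hM _ y1))//.
apply: (@le_trans _ _ ((M + 1) * `|y - x|)).
  by rewrite ler_wpM2r// lerDl.
by rewrite mulrC -ler_pdivlMr.
Qed.

(** The increments towards [x + h] and [x - h] have opposite coordinates, so the gradient at [x]
    cancels; what is left is the variation of the partials, itself Lipschitz. *)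
Lemma C2_second_difference phi x r : C2 phi ->
  exists2 C, 0 <= C & forall h, `|h| <= r ->
    `|phi (x + h) + phi (x - h) - 2 * phi x| <= C * `|h| ^+ 2.
Proof.
move=> [hphi hphi2].
have dphi i : forall y, derivable phi y (delta_mx 0 i) := (hphi i).1.
have /choice[M hM] (i : 'I_N) : exists M, 0 <= M /\ forall y, `|y - x| <= r ->
    `|'D_(delta_mx 0 i) phi y - 'D_(delta_mx 0 i) phi x| <= M * `|y - x|.
  by have [M M0 h] := C1_lipschitz x r (hphi2 i); exists M.
exists (\sum_i (2 * M i)).
  by apply: sumr_ge0 => i _; rewrite mulr_ge0// (hM i).1.
move=> h hr.
have [xi xir E1] := MVT_coordinates x (x + h) dphi.
have [yi yir E2] := MVT_coordinates x (x - h) dphi.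
have -> : phi (x + h) + phi (x - h) - 2 * phi x =
    (phi (x + h) - phi x) + (phi (x - h) - phi x) by ring.
rewrite E1 E2 -big_split/= mulr_suml.
rewrite (le_trans (ler_norm_sum _ _ _))// ler_sum// => i _.
have hn : x + h - x = h by rewrite addrC addKr.
have hn' : x - h - x = - h by rewrite addrC addKr.
have [h1 h2] : `|xi i - x| <= `|h| /\ `|yi i - x| <= `|h|.
  by have := xir i; have := yir i; rewrite hn hn' normrN.
have [M0 hMi] := hM i.
have := hMi (xi i) (le_trans h1 hr); have := hMi (yi i) (le_trans h2 hr).
set a := 'D__ phi (xi i); set b := 'D__ phi (yi i); set c := 'D__ phi x => k1 k2.
(* The partial derivative [c] at the centre is inserted for free, because its two contributions have
   opposite signs. *)
have -> : ((x + h) 0 i - x 0 i) * a + ((x - h) 0 i - x 0 i) * b =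
    h 0 i * ((a - c) - (b - c)) by rewrite !mxE; ring.
rewrite normrM (_ : 2 * M i * _ = `|h| * (2 * M i * `|h|)); last by ring.
rewrite ler_pM//.
  exact: coord_le_norm.
rewrite (le_trans (ler_normB _ _))//.
have j1 := ler_wpM2l M0 h1; have j2 := ler_wpM2l M0 h2.
by move: k1 k2 j1 j2; lra.
Qed.

Lemma norm_le_enorm x : `|x| <= enorm x.
Proof.
apply: norm_le_coord; first exact: sqrtr_ge0.
move=> i; rewrite -sqrtr_sqr ler_wsqrtr// (bigD1 i)//= lerDl.
by apply: sumr_ge0 => j _; exact: sqr_ge0.
Qed.

Lemma C2_line_bounds phi x delta : 0 < delta -> C2 phi ->
  exists C, forall z, enorm z = 1 ->
    (forall t, `|t| < delta -> `|phi (x + t *: z)| <= C) /\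
    (forall t, 0 < t < delta -> `|second_diff phi x z t| <= C * t ^+ 2).
Proof.
move=> d0 hphi.
have [C1 C10 h1] := continuous_bounded_ball x delta (C1_continuous hphi.1).
have [C2 C20 h2] := C2_second_difference x delta hphi.
exists (C1 + C2) => z z1.
have zt (t : R) : `|t *: z| <= `|t|.
  by rewrite normrZ ler_piMr// -z1 norm_le_enorm.
split => [t td|t /andP[t0 td]].
  apply: (@le_trans _ _ C1); last by rewrite lerDl.
  by apply: h1; rewrite addrC addKr (le_trans (zt t))// ltW.
have tz := zt t; rewrite (gtr0_norm t0) in tz.
apply: le_trans (h2 (t *: z) _) _; first by rewrite (le_trans tz)// ltW.
by rewrite ler_pM ?sqr_ge0 ?lerDr// ler_sqr ?nnegrE// ltW.
Qed.

Lemma continuous_line_measurable phi x z : continuous phi ->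
  line_measurable phi x z.
Proof.
move=> cphi; apply: continuous_measurable_fun => t.
apply: continuous_comp; last exact: cphi.
by apply: cvgD; [exact: cvg_cst|apply: cvgZr_tmp; exact: cvg_id].
Qed.

End SmoothFunctions.

(** * The max-min and mid-range functionals on functions of the direction *)

Section SphereFunctionals.
Context {R : realType} {N : nat}.
Implicit Types (z v : 'rV[R]_N) (F : 'rV[R]_N -> R) (A M c : R).

Definition unit_sphere : set 'rV[R]_N := [set z | enorm z = 1].

(** Each operator is minus such a functional of the map from direction to line operator ([E_opE]),
    so that both problems share all later arguments. *)
Definition sphere_functional (p : dirichlet_problem) F : R :=
  match p with
  | TraceProblem => \sum_(1 <= i < N.+1) maxmin F i
  | MidRangeProblem => inf (F @` unit_sphere) + sup (F @` unit_sphere)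
  end.

Lemma E_opE p s delta w phi x :
  E_op p s delta w phi x =
  - sphere_functional p (fun z => E_dir s z delta w phi x).
Proof. by case: p. Qed.

Lemma enormZ a v : enorm (a *: v) = `|a| * enorm v.
Proof.
rewrite /enorm -sqrtr_sqr -sqrtrM ?sqr_ge0// mulr_sumr.
by congr Num.sqrt; apply: eq_bigr => i _; rewrite mxE exprMn.
Qed.

Lemma enorm_eq0 v : (enorm v == 0) = (v == 0).
Proof.
rewrite /enorm sqrtr_eq0 le_eqVlt ltNge sumr_ge0 ?orbF; last first.
  by move=> i _; exact: sqr_ge0.
rewrite psumr_eq0; last by move=> i _; exact: sqr_ge0.
apply/allP/eqP => [v0|-> i _]; last by rewrite mxE expr0n eqxx.
apply/rowP => i; rewrite mxE; apply/eqP; rewrite -sqrf_eq0.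
by apply: v0; rewrite mem_index_enum.
Qed.

Lemma enorm_normalize v : v != 0 -> enorm ((enorm v)^-1 *: v) = 1.
Proof.
move=> v0; rewrite enormZ ger0_norm ?invr_ge0 ?sqrtr_ge0// mulVf//.
by rewrite enorm_eq0.
Qed.

Lemma enorm_delta (i : 'I_N) : enorm (delta_mx 0 i : 'rV[R]_N) = 1.
Proof.
rewrite /enorm (bigD1 i)//= mxE !eqxx/= big1 ?addr0 ?expr1n ?sqrtr1//.
by move=> j ji; rewrite mxE (negbTE ji) andbF expr0n.
Qed.

Lemma enormN v : enorm (- v) = enorm v.
Proof. by rewrite -scaleN1r enormZ normrN normr1 mul1r. Qed.

Lemma sphere_neq0 (S : {vspace 'rV[R]_N}) : (0 < \dim S)%N -> sphere S !=set0.
Proof.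
rewrite lt0n dimv_eq0 => S0; have v0 : vpick S != 0 by rewrite vpick0.
exists ((enorm (vpick S))^-1 *: vpick S); split; last exact: enorm_normalize.
by rewrite memvZ// memv_pick.
Qed.

Lemma subspace_of_dim (U : {vspace 'rV[R]_N}) k : (k <= \dim U)%N ->
  exists S : {vspace 'rV[R]_N}, (S <= U)%VS /\ \dim S = k.
Proof.
move=> kU; exists <<take k (vbasis U)>>%VS; split.
  by apply/span_subvP => v /mem_take /vbasis_mem.
have /eqP -> : free (take k (vbasis U)).
  apply: (@catl_free _ _ (drop k (vbasis U))).
  by rewrite cat_take_drop (basis_free (vbasisP U)).
by rewrite size_takel// size_tuple.
Qed.

Lemma dim_rowspace : \dim {:'rV[R]_N} = N.
Proof. by rewrite dimvf dim_matrix; exact: mul1n. Qed.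

(** Each infimum rises by at least [c] and suprema are monotone. The mid-range gains [c] from its
    infimum, the trace gains N * c >= c from its N terms. The bound [M] ensures that [sup] and [inf]
    are taken of bounded sets and are not default values. *)
Lemma sphere_functional_shift p F1 F2 M c : (0 < N)%N -> 0 <= c ->
  (forall z, enorm z = 1 -> `|F1 z| <= M) ->
  (forall z, enorm z = 1 -> `|F2 z| <= M) ->
  (forall z, enorm z = 1 -> F1 z + c <= F2 z) ->
  sphere_functional p F1 + c <= sphere_functional p F2.
Proof.
move=> N0 c0 F1M F2M F12.
have hlb F (B : set 'rV[R]_N) : (forall z, enorm z = 1 -> `|F z| <= M) ->
    B `<=` unit_sphere -> has_lbound (F @` B).
  move=> FM BU; exists (- M) => _ [z Bz <-].
  by have := FM _ (BU _ Bz); rewrite ler_norml => /andP[].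
have hub F (B : set 'rV[R]_N) : (forall z, enorm z = 1 -> `|F z| <= M) ->
    B `<=` unit_sphere -> has_ubound (F @` B).
  move=> FM BU; exists M => _ [z Bz <-].
  by have := FM _ (BU _ Bz); rewrite ler_norml => /andP[].
have infle (B : set 'rV[R]_N) : B !=set0 -> B `<=` unit_sphere ->
    inf (F1 @` B) + c <= inf (F2 @` B).
  move=> B0 BU; apply: lb_le_inf; first exact: image_nonempty.
  move=> _ [z Bz <-]; apply: le_trans (F12 _ (BU _ Bz)).
  by rewrite lerD2r; apply: ge_inf; [exact: hlb|exists z].
case: p => /=; last first.
  have U0 : unit_sphere !=set0.
    by exists (delta_mx 0 (Ordinal N0)); exact: enorm_delta.
  have := infle _ U0 (fun z h => h).
  have : sup (F1 @` unit_sphere) <= sup (F2 @` unit_sphere).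
    apply: ge_sup; first exact: image_nonempty.
    move=> _ [z Uz <-]; apply: (@le_trans _ _ (F2 z)).
      by apply: le_trans (F12 _ Uz); rewrite lerDl.
    by apply: ub_le_sup; [exact: hub|exists z].
  lra.
have maxle i : (0 < i < N.+1)%N -> maxmin F1 i + c <= maxmin F2 i.
  move=> /andP[i0 iN].
  have d0 : (0 < N - i + 1)%N by rewrite addn1.
  have dN : (N - i + 1 <= \dim {:'rV[R]_N})%N.
    by rewrite dim_rowspace; lia.
  rewrite -lerBrDr; apply: ge_sup.
    have [S [_ dS]] := subspace_of_dim dN.
    by exists (inf (F1 @` sphere S)); exists S.
  move=> _ [S /= dS <-]; rewrite lerBrDr.
  have S0 : sphere S !=set0 by apply: sphere_neq0; rewrite dS.
  have SU : sphere S `<=` unit_sphere by move=> z [].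
  apply: le_trans (infle _ S0 SU) _.
  apply: ub_le_sup; last by exists S.
  exists M => _ [T /= dT <-].
  have [z Tz] : sphere T !=set0 by apply: sphere_neq0; rewrite dT.
  have TU : sphere T `<=` unit_sphere by move=> ? [].
  apply: (@le_trans _ _ (F2 z)).
    by apply: ge_inf; [exact: hlb|exists z].
  by have := F2M _ (TU _ Tz); rewrite ler_norml => /andP[].
apply: (@le_trans _ _ (\sum_(1 <= i < N.+1) (maxmin F1 i + c))).
  rewrite big_split/= lerD2l big_const_nat subSS subn0 iter_addr_0.
  by rewrite -mulr_natr ler_peMr// ler1n.
by rewrite !big_nat; apply: ler_sum => i; exact: maxle.
Qed.

Lemma maxmin_ge F i c M (S : {vspace 'rV[R]_N}) :
  (forall z, enorm z = 1 -> `|F z| <= M) ->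
  \dim S = (N - i + 1)%N -> (forall z, sphere S z -> c <= F z) ->
  c <= maxmin F i.
Proof.
move=> FM dS cF; apply: (@le_trans _ _ (inf (F @` sphere S))).
  apply: lb_le_inf; last by move=> _ [z Sz <-]; exact: cF.
  by apply: image_nonempty; apply: sphere_neq0; rewrite dS addn1.
apply: ub_le_sup; last by exists S.
exists M => _ [T /= dT <-].
have [z Tz] : sphere T !=set0 by apply: sphere_neq0; rewrite dT addn1.
apply: (@le_trans _ _ (F z)).
  apply: ge_inf; last by exists z.
  exists (- M) => _ [y [_ y1] <-].
  by have := FM _ y1; rewrite ler_norml => /andP[].
by have := FM _ Tz.2; rewrite ler_norml => /andP[].
Qed.

Lemma maxmin_le F i c M : (0 < i)%N -> (i <= N)%N ->
  (forall z, enorm z = 1 -> `|F z| <= M) ->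
  (forall S : {vspace 'rV[R]_N}, \dim S = (N - i + 1)%N ->
    exists2 z, sphere S z & F z <= c) ->
  maxmin F i <= c.
Proof.
move=> i0 iN FM Fc.
have dN : (N - i + 1 <= \dim {:'rV[R]_N})%N by rewrite dim_rowspace; lia.
apply: ge_sup.
  have [S [_ dS]] := subspace_of_dim dN.
  by exists (inf (F @` sphere S)); exists S.
move=> _ [S /= dS <-]; have [z Sz zc] := Fc S dS.
apply: le_trans zc; apply: ge_inf; last by exists z.
exists (- M) => _ [y [_ y1] <-].
by have := FM _ y1; rewrite ler_norml => /andP[].
Qed.

Lemma sphere_line z v : enorm z = 1 -> sphere <[z]> v -> v = z \/ v = - z.
Proof.
move=> z1 [/vlineP[k ->]]; rewrite enormZ z1 mulr1 => k1.
have [k0|k0] := leP 0 k; first by left; rewrite -[k]ger0_norm// k1 scale1r.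
by right; rewrite -[k]opprK -(ltr0_norm k0) k1 scaleN1r.
Qed.

Lemma dim_unit_line z : enorm z = 1 -> \dim <[z]> = 1%N.
Proof.
by move=> z1; rewrite dim_vline -enorm_eq0 z1 oner_eq0.
Qed.

(** Rank-nullity on [S] for the coordinate functional [i], whose image has dimension at most 1. *)
Lemma capv_coordinate_hyperplane (S : {vspace 'rV[R]_N}) (i : 'I_N) :
  exists T : {vspace 'rV[R]_N}, [/\ (T <= S)%VS, (\dim S <= \dim T + 1)%N &
    forall z, z \in T -> z 0 i = 0].
Proof.
pose f := linfun (mulmxr (delta_mx i 0 : 'cV[R]_N) : 'rV[R]_N -> 'rV[R]_1).
exists (S :&: lker f)%VS; split; first exact: capvSl.
  rewrite -(limg_ker_dim f S) leq_add2l.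
  have := dimvS (subvf (f @: S)%VS); rewrite dimvf dim_matrix.
  by move=> /leq_trans; exact.
move=> z; rewrite memv_cap memv_ker => /andP[_ /eqP].
by rewrite lfunE/= -colE => /matrixP/(_ 0 0); rewrite !mxE.
Qed.

(** The minimum - A and the maximum A cancel, which settles the mid-range problem. For the trace
    they are the max-min values of index 1 (the whole space) and N (lines, whose unit vectors come
    in pairs, hence both signs of the axis [i0]). All intermediate values vanish: large subspaces
    meet the hyperplane of [i0], and the hyperplane of [i1] contains a competitor. *)
Lemma sphere_functional_balanced p F A (i0 i1 : 'I_N) : (2 <= N)%N ->
  (forall z, enorm z = 1 -> `|F z| <= A) ->
  (forall z, enorm z = 1 -> z 0 i0 = 0 -> F z <= 0) ->
  (forall z, enorm z = 1 -> z 0 i1 = 0 -> 0 <= F z) ->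
  F (delta_mx 0 i0) = A -> F (- delta_mx 0 i0) = A ->
  F (delta_mx 0 i1) = - A ->
  sphere_functional p F = 0.
Proof.
move=> N2 FA F0 F1 FA0 FA0' FA1.
have FAl z : enorm z = 1 -> - A <= F z.
  by move=> /FA; rewrite ler_norml => /andP[].
have FAr z : enorm z = 1 -> F z <= A.
  by move=> /FA; rewrite ler_norml => /andP[].
have e01 := enorm_delta i0; have e11 := enorm_delta i1.
case: p => /=; last first.
  have -> : inf (F @` unit_sphere) = - A.
    apply/le_anti/andP; split; last first.
      apply: lb_le_inf; last by move=> _ [z z1 <-]; exact: FAl.
      by exists (F (delta_mx 0 i0)); exists (delta_mx 0 i0).
    rewrite -FA1; apply: ge_inf; last by exists (delta_mx 0 i1).
    by exists (- A) => _ [z z1 <-]; exact: FAl.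
  have -> : sup (F @` unit_sphere) = A.
    apply/le_anti/andP; split.
      apply: ge_sup; last by move=> _ [z z1 <-]; exact: FAr.
      by exists (F (delta_mx 0 i0)); exists (delta_mx 0 i0).
    rewrite -[leLHS]FA0; apply: ub_le_sup; last by exists (delta_mx 0 i0).
    by exists A => _ [z z1 <-]; exact: FAr.
  by rewrite addNr.
rewrite big_ltn; last by lia.
rewrite big_nat_recr//=.
have -> : maxmin F 1 = - A.
  apply/le_anti/andP; split.
    apply: (maxmin_le _ _ FA) => //; first lia.
    move=> S dS; exists (delta_mx 0 i1); last by rewrite FA1.
    split => //; have -> : S = fullv; last exact: memvf.
    apply/eqP; rewrite eqEdim subvf dim_rowspace dS/=; lia.
  apply: (maxmin_ge (S := fullv) FA); first by rewrite dim_rowspace; lia.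
  by move=> z [_]; exact: FAl.
have -> : maxmin F N = A.
  apply/le_anti/andP; split.
    apply: (maxmin_le _ _ FA) => //; first lia.
    move=> S dS.
    have [z Sz] : sphere S !=set0 by apply: sphere_neq0; rewrite dS; lia.
    by exists z => //; apply: FAr; exact: Sz.2.
  apply: (maxmin_ge (S := <[(delta_mx 0 i0)%R]>%VS) FA).
    by rewrite dim_unit_line//; lia.
  by move=> z /(sphere_line e01)[->|->]; rewrite ?FA0 ?FA0'.
rewrite big1_seq ?add0r ?addNr// => i.
rewrite mem_index_iota => /andP[_ /andP[i2 iN]].
apply/le_anti/andP; split.
  apply: (maxmin_le _ _ FA); [lia..|].
  (* Here i < N, so [S] has dimension at least 2 and its trace [T] on the hyperplane is nonzero. *)
  move=> S dS; have [T [TS ST T0]] := capv_coordinate_hyperplane S i0.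
  have [z [Tz z1]] : sphere T !=set0 by apply: sphere_neq0; lia.
  exists z; last exact: F0 (T0 _ Tz).
  by split => //; exact: (subvP TS).
(* Here i >= 2, so the hyperplane, of dimension at least N - 1, has room for a subspace of dimension
   N - i + 1. *)
have [T [_ NT T0]] := capv_coordinate_hyperplane fullv i1.
have [|S [ST dS]] := @subspace_of_dim T (N - i + 1).
  by move: NT; rewrite dim_rowspace; lia.
apply: (maxmin_ge FA dS) => z [Sz z1]; apply: F1 => //; apply: T0.
exact: (subvP ST).
Qed.

(** All max-min values are nonnegative, and the last one, a supremum over lines, is at least [F z]
    because of the line through [z]. *)
Lemma sphere_functional_gt0 p F M z : (0 < N)%N ->
  (forall v, enorm v = 1 -> 0 <= F v <= M) -> enorm z = 1 ->
  0 < F z -> F (- z) = F z -> 0 < sphere_functional p F.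
Proof.
move=> N0 FM z1 Fz FNz.
have F0 v : enorm v = 1 -> 0 <= F v by move=> /FM/andP[].
have FM' v : enorm v = 1 -> `|F v| <= M.
  by move=> /FM/andP[h1 h2]; rewrite ger0_norm.
case: p => /=; last first.
  apply: ltr_wpDl.
    apply: lb_le_inf; last by move=> _ [v v1 <-]; exact: F0.
    by exists (F z); exists z.
  apply: lt_le_trans Fz _; apply: ub_le_sup; last by exists z.
  by exists M => _ [v v1 <-]; case/andP: (FM _ v1).
rewrite big_nat_recr//=; apply: ltr_wpDl.
  rewrite big_nat sumr_ge0// => i /andP[i0 iN].
  have [|S [_ dS]] := @subspace_of_dim fullv (N - i + 1).
    by rewrite dim_rowspace; lia.
  by apply: (maxmin_ge FM' dS) => v [_]; exact: F0.
apply: lt_le_trans Fz _; apply: (maxmin_ge (S := <[z]>%VS) FM').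
  by rewrite dim_unit_line//; lia.
by move=> v /(sphere_line z1)[->|->]; rewrite ?FNz.
Qed.

End SphereFunctionals.

(** * Monotonicity of the operators, with a gap from the tail of the kernel *)

Section Comparison.
Context {R : realType} {N : nat}.
Local Notation mu := (@lebesgue_measure R).
Variable s : R.
Hypothesis hs : 2^-1 < s < 1.
Implicit Types (x z : 'rV[R]_N) (w phi : 'rV[R]_N -> R) (t delta C : R).

Lemma exponent_bounds : 2 < 1 + 2 * s < 3.
Proof. by move/andP: hs => [s1 s2]; apply/andP; lra. Qed.

Lemma integrable_scale (D : set R) c (f : R -> R) : measurable D ->
  mu.-integrable D (EFin \o f) -> mu.-integrable D (EFin \o (fun t => c * f t)).
Proof. by move=> mD; exact: integrableZl. Qed.

Lemma integrable_add (D : set R) (f g : R -> R) : measurable D ->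
  mu.-integrable D (EFin \o f) -> mu.-integrable D (EFin \o g) ->
  mu.-integrable D (EFin \o (fun t => f t + g t)).
Proof. by move=> mD; exact: integrableD. Qed.

Lemma E_dirE_C2 delta w phi x z C : 0 < delta -> C2 phi -> continuous w ->
  (forall y, `|w y| <= C) -> enorm z = 1 ->
  mu.-integrable `]0, +oo[
    (EFin \o (fun t => spliced_diff delta w phi x z t / t `^ (1 + 2 * s))) /\
  E_dir s z delta w phi x =
  \int[mu]_(t in `]0, +oo[) (spliced_diff delta w phi x z t / t `^ (1 + 2 * s)).
Proof.
move=> d0 hphi cw wC z1.
have [C' /(_ z z1)[h1 h2]] := C2_line_bounds x d0 hphi.
have C0 : 0 <= C by apply: le_trans (wC x).
have C0' : 0 <= C'.
  by have := h1 0; rewrite normr0 => /(_ d0); apply: le_trans.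
apply: (@E_dirE _ _ _ hs _ _ _ _ _ (C + C')) => //.
- by apply: continuous_line_measurable; apply: C1_continuous; case: hphi.
- exact: continuous_line_measurable.
- by move=> t td; rewrite (le_trans (h1 t td))// lerDr.
- by move=> t td; rewrite (le_trans (h2 t td))// ler_wpM2r ?sqr_ge0// lerDr.
- by move=> t; rewrite (le_trans (wC _))// lerDl.
Qed.

(** Uniformity in the direction is the point: it makes the suprema and infima over the sphere
    genuine. *)
Lemma E_dir_bounded delta w phi x C : 0 < delta -> C2 phi -> continuous w ->
  (forall y, `|w y| <= C) ->
  exists M, forall z, enorm z = 1 -> `|E_dir s z delta w phi x| <= M.
Proof.
move=> d0 hphi cw wC; have [p2 p3] := andP exponent_bounds.
have [C' h] := C2_line_bounds x d0 hphi.
pose K := `|C'| + 4 * `|C|.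
have C0 := normr_ge0 C; have C0' := normr_ge0 C'.
pose g t := if t < delta then K * t ^+ 2 else K.
have mg : measurable_fun [set: R] g.
  apply: measurable_fun_ifT => //; first exact: measurable_fun_ltr.
  by apply: measurable_funM => //; exact: exprn_measurable.
pose L := K + K * delta ^+ 2 + K / delta ^+ 2.
have d20 : 0 < delta ^+ 2 by rewrite exprn_gt0.
have K0 : 0 <= K by rewrite /K; lra.
have Kd0 : 0 <= K * delta ^+ 2 by rewrite mulr_ge0// ltW.
have Kd0' : 0 <= K / delta ^+ 2 by rewrite divr_ge0// ltW.
have gi : mu.-integrable `]0, +oo[ (EFin \o (fun t => g t / t `^ (1 + 2 * s))).
  apply: (@integrable_kernel _ _ L) => //; first exact: exponent_bounds.
    move=> t /andP[t0 t1]; rewrite /g; case: ifPn => td.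
      rewrite (ger0_norm (mulr_ge0 K0 (sqr_ge0 t))) ler_wpM2r ?sqr_ge0//.
      by rewrite /L; lra.
    rewrite (ger0_norm K0); apply: (@le_trans _ _ (K / delta ^+ 2 * t ^+ 2)).
      rewrite -mulrA ler_peMr// mulrC ler_pdivlMr// mul1r.
      by rewrite ler_sqr ?nnegrE ?(ltW t0) ?(ltW d0)// leNgt.
    by rewrite ler_wpM2r ?sqr_ge0// /L; lra.
  move=> t t1; have t0 : 0 < t by lra.
  apply: (@le_trans _ _ (L * 1)); last first.
    apply: ler_wpM2l; first by rewrite /L; lra.
    have := ler_powR t1 (_ : 0 <= 1 + 2 * s - 2).
    by rewrite powRr0; apply; rewrite subr_ge0 ltW.
  rewrite mulr1 /g; case: ifPn => td; last by rewrite (ger0_norm K0) /L; lra.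
  rewrite (ger0_norm (mulr_ge0 K0 (sqr_ge0 t))).
  apply: (@le_trans _ _ (K * delta ^+ 2)); last by rewrite /L; lra.
  by rewrite ler_wpM2l// ler_sqr ?nnegrE ?(ltW t0) ?(ltW d0)// ltW.
exists (\int[mu]_(t in `]0, +oo[) (g t / t `^ (1 + 2 * s))) => z z1.
have [i ->] := E_dirE_C2 x d0 hphi cw wC z1.
apply: le_trans (le_normr_Rintegral _ i) _ => //.
apply: le_Rintegral => //; first exact: integrable_norm.
move=> t /=; rewrite in_itv/= andbT => t0.
have tp : 0 <= (t `^ (1 + 2 * s))^-1 by rewrite invr_ge0 powR_ge0.
rewrite normrM (ger0_norm tp) ler_wpM2r// /spliced_diff /g.
case: ifPn => td.
  have [_ h2] := h _ z1; apply: le_trans (h2 t _) _; first by rewrite t0.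
  rewrite ler_wpM2r ?sqr_ge0// /K (le_trans (ler_norm _))//; lra.
rewrite /second_diff /K.
have := wC (x + t *: z); have := wC (x - t *: z); have := wC x.
have := ler_norm C.
by rewrite !ler_norml; lra.
Qed.

(** The cut-off sits in the integrand, so that all compared integrals run over the same
    half-line. *)
Definition kernel_tail (T : R) : R :=
  \int[mu]_(t in `]0, +oo[) ((if T <= t then 1 else 0) / t `^ (1 + 2 * s)).

Lemma kernel_tail_integrable (T : R) : 0 < T ->
  mu.-integrable `]0, +oo[
    (EFin \o (fun t => (if T <= t then 1 else 0) / t `^ (1 + 2 * s))).
Proof.
move=> T0; have [p2 p3] := andP exponent_bounds.
have T20 : 0 < T ^+ 2 by rewrite exprn_gt0.
have T20' : 0 < (T ^+ 2)^-1 by rewrite invr_gt0.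
apply: (@integrable_kernel _ _ (1 + (T ^+ 2)^-1)).
- exact: exponent_bounds.
- by apply: measurable_fun_ifT => //; exact: measurable_fun_ler.
- move=> t /andP[t0 t1]; case: ifPn => Tt; last first.
    by rewrite normr0 mulr_ge0 ?sqr_ge0//; lra.
  rewrite normr1; apply: (@le_trans _ _ ((T ^+ 2)^-1 * t ^+ 2)).
    by rewrite mulrC ler_pdivlMr// mul1r ler_sqr ?nnegrE ?(ltW t0) ?(ltW T0).
  by rewrite ler_wpM2r ?sqr_ge0//; lra.
- move=> t t1; apply: (@le_trans _ _ 1).
    by case: ifPn; rewrite ?normr1 ?normr0.
  have := ler_powR t1 (_ : 0 <= 1 + 2 * s - 2).
  rewrite powRr0 subr_ge0 => /(_ (ltW p2)).
  by move: (_ `^ _) => b b1; nra.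
Qed.

Lemma Rintegral_gt0 (f : R -> R) (a b c : R) : 0 < a < b -> 0 < c ->
  mu.-integrable `]0, +oo[ (EFin \o f) -> (forall t, 0 < t -> 0 <= f t) ->
  (forall t, a <= t <= b -> c <= f t) -> 0 < \int[mu]_(t in `]0, +oo[) f t.
Proof.
move=> /andP[a0 ab] c0 fi f0 fc.
have ii : mu.-integrable `]0, +oo[
    (EFin \o (\1_(`[a, b]%classic : set R) : R -> R)).
  by apply: (@integrableS _ _ _ _ setT) => //; exact: integrable_indic_itv.
apply: (@lt_le_trans _ _ (\int[mu]_(t in `]0, +oo[)
    (c * \1_(`[a, b]%classic : set R) t))).
  rewrite RintegralZl// mulr_gt0//.
  rewrite /Rintegral integral_indic//= setIidl; last first.
    by move=> t /=; rewrite !in_itv/= andbT => /andP[/(lt_le_trans a0)].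
  by rewrite lebesgue_measure_itv/= lte_fin ab -EFinB/= subr_gt0.
apply: le_Rintegral => //; first exact: integrable_scale.
move=> t /=; rewrite in_itv/= andbT => t0; rewrite indicE.
have -> : (t \in (`[a, b]%classic : set R)) = (a <= t <= b).
  by apply/idP/idP; rewrite inE/= in_itv.
by case: (boolP (a <= t <= b)) => [/fc|_]; rewrite ?mulr1 ?mulr0 ?f0.
Qed.

Lemma kernel_tail_gt0 (T : R) : 0 < T -> 0 < kernel_tail T.
Proof.
move=> T0; have [p2 p3] := andP exponent_bounds; have T1 : 0 < T + 1 by lra.
apply: (@Rintegral_gt0 _ T (T + 1) ((T + 1) `^ (1 + 2 * s))^-1).
- by rewrite T0 ltrDl ltr01.
- by rewrite invr_gt0 powR_gt0.
- exact: kernel_tail_integrable.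
- by move=> t t0; rewrite divr_ge0 ?powR_ge0//; case: ifP.
move=> t /andP[Tt tT]; rewrite Tt mul1r lef_pV2 ?posrE ?powR_gt0//; last lra.
by apply: ge0_ler_powR; rewrite ?nnegrE; lra.
Qed.

(** Taking m = 0 gives plain monotonicity; a positive [m] records a difference that persists for t
    >= T and yields strict inequalities. *)
Lemma E_dir_compare d1 d2 w1 w2 phi1 phi2 x z C T m :
  0 < d1 -> 0 < d2 -> C2 phi1 -> C2 phi2 -> continuous w1 -> continuous w2 ->
  (forall y, `|w1 y| <= C) -> (forall y, `|w2 y| <= C) -> enorm z = 1 -> 0 < T ->
  (forall t, 0 < t ->
     spliced_diff d1 w1 phi1 x z t + m * (if T <= t then 1 else 0) <=
     spliced_diff d2 w2 phi2 x z t) ->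
  E_dir s z d1 w1 phi1 x + m * kernel_tail T <= E_dir s z d2 w2 phi2 x.
Proof.
move=> d10 d20 hphi1 hphi2 cw1 cw2 w1C w2C z1 T0 le12.
have [i1 ->] := E_dirE_C2 x d10 hphi1 cw1 w1C z1.
have [i2 ->] := E_dirE_C2 x d20 hphi2 cw2 w2C z1.
have i3 := kernel_tail_integrable T0.
have i4 : mu.-integrable `]0, +oo[
    (EFin \o (fun t => m * ((if T <= t then 1 else 0) / t `^ (1 + 2 * s)))).
  exact: integrable_scale.
rewrite /kernel_tail -RintegralZl// -RintegralD//.
apply: le_Rintegral => //.
  exact: integrable_add.
move=> t /=; rewrite in_itv/= andbT => t0.
by rewrite mulrA -mulrDl ler_wpM2r ?le12// invr_ge0 powR_ge0.
Qed.

End Comparison.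

(** * Euclidean balls against the sup norm; semicontinuity and continuity *)

Section EuclideanTopology.
Context {R : realType} {N : nat}.
Implicit Types (x y z : 'rV[R]_N) (u v g : 'rV[R]_N -> R).
Implicit Type Omega : set 'rV[R]_N.

Lemma eball_line x z (t delta : R) : enorm z = 1 -> `|t| < delta ->
  eball x delta (x + t *: z).
Proof. by move=> z1 td; rewrite /eball/= addrC addKr enormZ z1 mulr1. Qed.

Lemma enorm_le_norm x : enorm x <= N%:R * `|x|.
Proof.
rewrite /enorm -[leRHS]ger0_norm ?mulr_ge0// -sqrtr_sqr ler_wsqrtr//.
apply: (@le_trans _ _ (\sum_(i < N) `|x| ^+ 2)).
  apply: ler_sum => i _; rewrite -real_normK ?num_real//.
  by rewrite ler_sqr ?nnegrE//; exact: coord_le_norm.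
rewrite sumr_const card_ord exprMn -[leLHS]mulr_natl ler_wpM2r ?sqr_ge0//.
by rewrite -natrX ler_nat; case: (N) => // n; rewrite expnS expn1 leq_pmulr.
Qed.

Lemma open_eball Omega x : open Omega -> Omega x ->
  exists2 delta : R, 0 < delta & eball x delta `<=` Omega.
Proof.
move=> oO Ox; have /nbhs_normP[d /= d0 dO] : nbhs x Omega by exact: open_nbhs_nbhs.
exists d => // y yd; apply: dO; rewrite /= -normrN opprB.
exact: le_lt_trans (norm_le_enorm _) yd.
Qed.

Lemma continuous_normP (f : 'rV[R]_N -> R) x :
  (forall e, 0 < e -> exists2 d : R, 0 < d &
     forall y, `|y - x| < d -> `|f y - f x| < e) ->
  {for x, continuous f}.
Proof.
move=> h; apply/(@cvgrPdist_lt _ _ _ (nbhs x)) => e e0.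
have [d d0 hd] := h e e0.
apply: (iffRL (nbhs_normP x _)); exists d => // y /=.
by rewrite distrC => /hd; rewrite distrC.
Qed.

Lemma continuous_at_norm (f : 'rV[R]_N -> R) x e : {for x, continuous f} -> 0 < e ->
  exists2 d : R, 0 < d & forall y, `|y - x| < d -> `|f y - f x| < e.
Proof.
move=> /(@cvgrPdist_lt _ _ _ (nbhs x)) h e0.
have [d /= d0 hd] := iffLR (nbhs_normP x _) (h _ e0).
by exists d => // y; rewrite distrC => /hd /=; rewrite distrC.
Qed.

Lemma nbhs_dist_lt x (d : R) : 0 < d -> nbhs x [set y | `|y - x| < d].
Proof.
move=> d0; apply: (iffRL (nbhs_normP x _)); exists d => // y /=.
by rewrite distrC.
Qed.

Lemma semicontinuous_continuous u : upper_semicontinuous u ->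
  lower_semicontinuous (fun x => (u x)%:E) -> continuous u.
Proof.
move=> uu lu x; apply: continuous_normP => e e0.
have [V1 nV1 h1] : exists2 V, nbhs x V &
    forall y, V y -> ((- u x - e)%:E < (- u y)%:E)%E.
  by apply: uu; rewrite lte_fin; lra.
have [V2 nV2 h2] : exists2 V, nbhs x V &
    forall y, V y -> ((u x - e)%:E < (u y)%:E)%E.
  by apply: lu; rewrite lte_fin; lra.
have /nbhs_normP[d /= d0 hd] : nbhs x (V1 `&` V2) by exact: filterI.
exists d => // y yd; have [|/h1 + /h2] := hd y; first by rewrite /= distrC.
by rewrite !lte_fin ltr_norml; lra.
Qed.

Lemma continuous_semicontinuous u : continuous u ->
  upper_semicontinuous u /\ lower_semicontinuous (fun x => (u x)%:E).
Proof.
move=> cu; split=> x a; rewrite lte_fin => ax.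
  have [d d0 hd] := continuous_at_norm (e := - u x - a) (cu x) ltac:(lra).
  exists [set y | `|y - x| < d].
    exact: nbhs_dist_lt.
  by move=> y /hd; rewrite lte_fin ltr_norml; lra.
have [d d0 hd] := continuous_at_norm (e := u x - a) (cu x) ltac:(lra).
exists [set y | `|y - x| < d].
  exact: nbhs_dist_lt.
by move=> y /hd; rewrite lte_fin ltr_norml; lra.
Qed.

End EuclideanTopology.

(** * Exterior points near the boundary, and trivial extensions *)

Section BoundaryAndExtensions.
Context {R : realType} {N : nat}.
Implicit Types (x y z : 'rV[R]_N) (u v g : 'rV[R]_N -> R).
Implicit Type Omega : set 'rV[R]_N.

Lemma enorm_continuous x : continuous (fun y => enorm (y - x)).
Proof.
have -> : (fun y => enorm (y - x)) =
    (fun y => Num.sqrt (\sum_(i < N) (y 0 i - x 0 i) ^+ 2)).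
  apply/funext => y; rewrite /enorm; congr Num.sqrt.
  by apply: eq_bigr => i _; rewrite !mxE.
move=> y; apply: (continuous_comp
  (f := fun y : 'rV[R]_N => \sum_(i < N) (y 0 i - x 0 i) ^+ 2)
  (g := Num.sqrt)); last exact: sqrt_continuous.
move: y; apply: continuous_big => [|i _ y]; first exact: add_continuous.
apply: (continuous_comp (f := fun y : 'rV[R]_N => y 0 i - x 0 i)
  (g := fun t : R => t ^+ 2)); last exact: exprn_continuous.
exact: (cvgB (@coord_continuous _ _ _ 0 i y) (cvg_cst (x 0 i))).
Qed.

(** A frontier point of a general open set need not be a limit of exterior points (a puncture is
    not). Here the graph representation supplies them: a small move below the graph reaches a point
    with a whole neighbourhood below the graph. *)
Lemma frontier_near_exterior Omega x (e : R) : bounded_C2_domain Omega ->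
  frontier Omega x -> 0 < e ->
  exists2 y, `|y - x| < e & ~ closure Omega y.
Proof.
move=> [_ oO _ _ hO] fx e0; have [i [b [gamma [r [hgamma r0 hr]]]]] := hO x fx.
have xO : ~ Omega x.
  by move: fx; rewrite /frontier (iffLR (interior_id _) oO) => -[].
pose sg : R := (-1) ^+ b.
have sg2 : sg * sg = 1 by rewrite -expr2 sqrr_sign.
have sgn : `|sg| = 1 by rewrite normr_sign.
have N0 : (0 < N)%N := leq_ltn_trans (leq0n i) (ltn_ord i).
(* Half the minimum keeps the moved point within distance [e] and strictly inside the chart, where a
   neighbourhood of it still fits. *)
pose m := Num.min e r / 2.
have er0 : 0 < Num.min e r by rewrite lt_min e0.
have [mne mnr] : Num.min e r <= e /\ Num.min e r <= r.
  by rewrite !ge_min !lexx orbT.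
have [m0 me mr] : [/\ 0 < m, m < e & m < r] by rewrite /m; split; lra.
pose y := x - (m * sg) *: delta_mx 0 i.
have yx : y - x = - ((m * sg) *: delta_mx 0 i) by rewrite /y addrC addKr.
have eyx : enorm (y - x) = m.
  by rewrite yx enormN enormZ enorm_delta mulr1 normrM sgn mulr1 gtr0_norm.
exists y; first by apply: le_lt_trans (norm_le_enorm _) _; rewrite eyx.
have sx : sg * x 0 i <= gamma (col' i x).
  rewrite leNgt; apply/negP => sx; apply: xO; apply/hr => //.
  by rewrite /eball/= subrr -[0](scale0r 0) enormZ normr0 mul0r.
have sy : sg * y 0 i < gamma (col' i y).
  have -> : col' i y = col' i x.
    apply/matrixP => k l; rewrite !mxE [lift i l == i]eq_sym.
    rewrite (negbTE (neq_lift i l)) andbF.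
    by rewrite mulr0 subr0.
  apply: lt_le_trans sx; rewrite !mxE !eqxx mulr1 mulrBr mulrCA sg2 mulr1.
  by rewrite ltrBlDr ltrDl.
have cgamma : continuous gamma by apply: C1_continuous; case: hgamma.
have cy : continuous (fun w : 'rV[R]_N => gamma (col' i w) - sg * w 0 i).
  move=> w; apply: continuous_normP => d d0.
  have d20 : 0 < d / 2 by lra.
  have [d1 d10 hd1] := continuous_at_norm (cgamma (col' i w)) d20.
  exists (Num.min d1 (d / 2)); first by rewrite lt_min d10.
  move=> w'; rewrite lt_min => /andP[w1 w2].
  have h1 : `|gamma (col' i w') - gamma (col' i w)| < d / 2.
    apply: hd1; apply: le_lt_trans w1; apply: norm_le_coord => // k.
    by have := coord_le_norm (w' - w) (lift i k); rewrite !mxE.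
  have h2 : `|sg * w' 0 i - sg * w 0 i| < d / 2.
    rewrite -mulrBr normrM sgn mul1r; apply: le_lt_trans w2.
    by have := coord_le_norm (w' - w) i; rewrite !mxE.
  by move: h1 h2; rewrite !ltr_norml; lra.
have sy0 : 0 < gamma (col' i y) - sg * y 0 i by rewrite subr_gt0.
have [d d0 hd] := continuous_at_norm (cy y) sy0.
have rm0 : 0 < r - m by lra.
have [d' d'0 hd'] := continuous_at_norm
  (f := fun w => enorm (w - x)) (x := y) (@enorm_continuous x y) rm0.
have dd0 : 0 < Num.min d d' by rewrite lt_min d0.
move=> /(_ [set w | `|w - y| < Num.min d d'] (nbhs_dist_lt _ dd0)).
move=> [w [Ow]] /=; rewrite lt_min => /andP[wd wd'].
have := hd' _ wd'; rewrite eyx ltr_norml => /andP[_ wr].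
have /hr[/(_ Ow) + _] : eball x r w by rewrite /eball/=; lra.
by have := hd _ wd; rewrite ltr_norml -/sg; lra.
Qed.

Lemma upper_ext_id Omega g u : (forall x, ~ Omega x -> u x = g x) ->
  upper_ext Omega g u = u.
Proof.
move=> ug; apply/funext => x; rewrite /upper_ext.
have [//|/negP] := boolP (x \in Omega); rewrite inE => /ug <-.
by rewrite maxxx if_same.
Qed.

Lemma lower_ext_id Omega g u : (forall x, ~ Omega x -> u x = g x) ->
  lower_ext Omega g u = u.
Proof.
move=> ug; apply/funext => x; rewrite /lower_ext.
have [//|/negP] := boolP (x \in Omega); rewrite inE => /ug <-.
by rewrite minxx if_same.
Qed.

End BoundaryAndExtensions.

(** * A classical solution is the only viscosity solution for its own values *)

Section ClassicalSolutions.
Context {R : realType} {N : nat}.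
Variables (p : dirichlet_problem) (s : R) (Omega : set 'rV[R]_N).
Hypotheses (hs : 2^-1 < s < 1) (N0 : (0 < N)%N).
Hypothesis hOmega : bounded_C2_domain Omega.
(** [phi0] is kept apart from [U] because [U] will contain a tent with a kink outside Omega, whereas
    a test function has to be C^2 everywhere. *)
Variables (U phi0 : 'rV[R]_N -> R) (C : R).
Hypotheses (cU : continuous U) (UC : forall x, `|U x| <= C).
Hypotheses (hphi0 : C2 phi0) (phi0U : forall x, Omega x -> phi0 x = U x).
Hypothesis U_solves : forall x (delta : R), Omega x -> 0 < delta ->
  eball x delta `<=` Omega ->
  sphere_functional p (fun z => E_dir s z delta U phi0 x) = 0.
Implicit Types (x z : 'rV[R]_N) (v phi : 'rV[R]_N -> R).

Let oOmega : open Omega. Proof. by case: hOmega. Qed.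

Lemma bounded_fun_abs v : bounded_fun v -> exists2 M, 0 < M & forall x, `|v x| <= M.
Proof.
move=> [M [_ hM]]; exists (`|M| + 1); first by have := normr_ge0 M; lra.
by move=> x; apply: hM => //; have := ler_norm M; lra.
Qed.

Lemma abs_bounded_fun v M : (forall x, `|v x| <= M) -> bounded_fun v.
Proof.
move=> vM; exists M; split; first exact: num_real.
by move=> K MK x _; exact: le_trans (vM x) (ltW MK).
Qed.

Lemma second_diff_spliced delta x z (t : R) : Omega x -> 0 < t ->
  eball x delta `<=` Omega -> enorm z = 1 ->
  spliced_diff delta U phi0 x z t = second_diff U x z t.
Proof.
move=> Ox t0 dO z1; rewrite /spliced_diff; case: ifPn => // td.
have nt : `|t| < delta by rewrite gtr0_norm.
have Op : Omega (x + t *: z) by apply: dO; exact: eball_line.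
have Om : Omega (x - t *: z).
  by rewrite -scaleNr; apply: dO; apply: eball_line => //; rewrite normrN.
by rewrite /second_diff (phi0U Op) (phi0U Om) (phi0U Ox).
Qed.

Lemma small_eball x (delta : R) : Omega x -> 0 < delta ->
  exists d : R, [/\ 0 < d, d <= delta & eball x d `<=` Omega].
Proof.
move=> Ox d0; have [d d1 dO] := open_eball oOmega Ox.
exists (Num.min d delta); split; first by rewrite lt_min d1.
  by rewrite ge_min lexx orbT.
by move=> y; rewrite /eball/= lt_min => /andP[yd _]; exact: dO.
Qed.

(** At a touching point the second differences of the test function lie on one side of those of [U],
    so monotonicity suffices. On the frontier u - g = 0, which satisfies both boundary
    alternatives. *)
Lemma solution_self : viscosity_solution p s Omega U U.
Proof.
have [uU lU] := continuous_semicontinuous cU.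
have bU : bounded_fun U by exact: abs_bounded_fun UC.
have refl_ext x : ~ Omega x -> U x = U x by [].
have [sup_ext inf_ext] := (upper_ext_id refl_ext, lower_ext_id refl_ext).
split; split => // delta phi x0 d0 hphi touch; rewrite ?sup_ext ?inf_ext.
- split=> [Ox|_]; last by rewrite subrr ge_min lexx orbT.
  (* The ball on which the test function touches may leave Omega, so the equation is used with a
     smaller radius [d]. Within [d] the functions [phi0] and [U] agree, and splicing has no
     effect. *)
  have [d [d1 dd dO]] := small_eball Ox d0.
  have [M1 hM1] := E_dir_bounded hs x0 d0 hphi cU UC.
  have [M2 hM2] := E_dir_bounded hs x0 d1 hphi0 cU UC.
  rewrite E_opE oppr_le0 -(U_solves Ox d1 dO) -[leLHS]addr0.
  apply: (@sphere_functional_shift _ _ _ _ _ (M1 + M2)) => // z z1.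
  + rewrite (le_trans (hM2 z z1))// lerDr.
    exact: le_trans (normr_ge0 _) (hM1 z z1).
  + rewrite (le_trans (hM1 z z1))// lerDl.
    exact: le_trans (normr_ge0 _) (hM2 z z1).
  rewrite -(mul0r (kernel_tail s 1)).
  apply: (@E_dir_compare _ _ _ hs _ _ _ _ _ _ _ _ C) => // t t0.
  rewrite mul0r addr0 second_diff_spliced// /spliced_diff.
  case: ifPn => // td; have nt : `|t| < delta by rewrite gtr0_norm.
  have h1 := touch _ (eball_line x0 z1 nt).
  have h2 : U (x0 - t *: z) - phi (x0 - t *: z) <= U x0 - phi x0.
    by apply: touch; rewrite -scaleNr; apply: eball_line; rewrite ?normrN.
  by move: h1 h2; rewrite /second_diff; lra.
- split=> [Ox|_]; last by rewrite subrr le_max lexx orbT.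
  have [d [d1 dd dO]] := small_eball Ox d0.
  have [M1 hM1] := E_dir_bounded hs x0 d0 hphi cU UC.
  have [M2 hM2] := E_dir_bounded hs x0 d1 hphi0 cU UC.
  rewrite E_opE oppr_ge0 -(U_solves Ox d1 dO) -[leLHS]addr0.
  apply: (@sphere_functional_shift _ _ _ _ _ (M1 + M2)) => // z z1.
  + rewrite (le_trans (hM1 z z1))// lerDl.
    exact: le_trans (normr_ge0 _) (hM2 z z1).
  + rewrite (le_trans (hM2 z z1))// lerDr.
    exact: le_trans (normr_ge0 _) (hM1 z z1).
  rewrite -(mul0r (kernel_tail s 1)).
  apply: (@E_dir_compare _ _ _ hs _ _ _ _ _ _ _ _ C) => // t t0.
  rewrite mul0r addr0 [leRHS]second_diff_spliced// /spliced_diff.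
  case: ifPn => // td; have nt : `|t| < delta by rewrite gtr0_norm.
  have h1 := touch _ (eball_line x0 z1 nt).
  have h2 : U x0 - phi x0 <= U (x0 - t *: z) - phi (x0 - t *: z).
    by apply: touch; rewrite -scaleNr; apply: eball_line; rewrite ?normrN.
  by move: h1 h2; rewrite /second_diff; lra.
Qed.

Lemma positive_max (f : 'rV[R]_N -> R) y : continuous f ->
  (forall x, ~ Omega x -> f x = 0) -> 0 < f y ->
  exists c, [/\ Omega c, 0 < f c & forall x, f x <= f c].
Proof.
move=> cf f0 fy; have [_ _ _ [B [_ hB]] _] := hOmega.
have cO : compact (closure Omega).
  apply: bounded_closed_compact; last exact: closed_closure.
  exists (B + 1); split; first exact: num_real.
  move=> M BM; have BM' : B < M - 1 by lra.
  move=> x /(_ [set w | `|w - x| < 1] (nbhs_dist_lt _ ltr01)).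
  move=> [w [Ow /= wx]]; have wM : `|w| <= M - 1 := hB _ BM' _ Ow.
  by have := ler_distD w x 0; rewrite !subr0 [`|x - w|]distrC; lra.
have Oy : Omega y by apply: contrapT => /f0; lra.
have [c _ hc] := @EVT_max_rV _ _ f _ (ex_intro _ y (subset_closure Oy)) cO
  (continuous_subspaceT cf).
have fc : 0 < f c.
  by apply: lt_le_trans fy _; apply: hc; rewrite inE; exact: subset_closure.
exists c; split => //; first by apply: contrapT => /f0; lra.
move=> x; have [Ox|/f0 ->] := pselect (Omega x); last exact: ltW.
by apply: hc; rewrite inE; exact: subset_closure.
Qed.

Lemma exits_Omega c : exists2 T : R, 0 < T &
  forall z (t : R), enorm z = 1 -> T <= `|t| -> ~ Omega (c + t *: z).
Proof.
have [_ _ _ [B [_ hB]] _] := hOmega.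
pose K := `|B| + 1 + `|c|.
have K0 : 0 < K by rewrite /K; have := normr_ge0 B; have := normr_ge0 c; lra.
(* Omega is bounded in the sup norm, while |t| is the Euclidean length of [t *: z]; the factor N
   compares the two norms. *)
exists (N%:R * K + 1) => [|z t z1 Tt Ot].
  by rewrite ltr_wpDl// mulr_ge0// ltW.
have B1 : B < `|B| + 1 by have := ler_norm B; lra.
have hBo : `|c + t *: z| <= `|B| + 1 := hB _ B1 _ Ot.
have tz : `|t *: z| <= K.
  rewrite -[t *: z](addKr c) addrC (le_trans (ler_normB _ _))//.
  by rewrite /K lerD2r.
have := le_trans (enorm_le_norm (t *: z)) (ler_wpM2l (ler0n R N) tz).
by rewrite enormZ z1 mulr1; lra.
Qed.

(** At a positive maximum of v - U the function [phi0] touches [v] from above. All second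
    differences of [v] are then at most those of [U], and smaller by twice the maximum once the line
    has left Omega at both ends. The functional of [v] is therefore negative, against the
    subsolution property; the other sign is symmetric. *)
Lemma solution_unique v : viscosity_solution p s Omega U v -> v =1 U.
Proof.
move=> [[/bounded_fun_abs[M M0 vM] uv vU sub] [_ lv Uv super]].
have cv := semicontinuous_continuous uv lv.
have v_ext x : ~ closure Omega x -> v x = U x.
  by move=> xO; apply/le_anti; rewrite vU// Uv.
have cd : continuous (fun x => v x - U x).
  by move=> x; apply: (@continuousB _ _ _ v U x); [exact: cv|exact: cU].
(* Both semicontinuities make [v] continuous, so its agreement with [U] outside the closure extends
   to the frontier. *)
have v_out x : ~ Omega x -> v x = U x.
  move=> xO; have [xc|/v_ext//] := pselect (closure Omega x).
  have fx : frontier Omega x by split => //; rewrite (iffLR (interior_id _) oOmega).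
  apply/eqP; rewrite -subr_eq0; apply/negPn/negP => vx.
  have e0 : 0 < `|v x - U x| by rewrite normr_gt0.
  have [d d0 hd] := continuous_at_norm (cd x) e0.
  have [y yd yc] := frontier_near_exterior hOmega fx d0.
  by have := hd y yd; rewrite /= (v_ext _ yc) subrr sub0r normrN ltxx.
have [sup_ext inf_ext] := (upper_ext_id v_out, lower_ext_id v_out).
pose C' := C + M.
have UC' y : `|U y| <= C' by rewrite (le_trans (UC y))// lerDl ltW.
have C0 : 0 <= C by apply: le_trans (UC 0).
have vC' y : `|v y| <= C' by rewrite (le_trans (vM y))// lerDr.
have d_out x : ~ Omega x -> v x - U x = 0 by move=> /v_out ->; rewrite subrr.
have d'_out x : ~ Omega x -> U x - v x = 0 by move=> /v_out ->; rewrite subrr.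
have cd' : continuous (fun x => U x - v x).
  by move=> x; apply: (@continuousB _ _ _ U v x); [exact: cU|exact: cv].
move=> y; apply/eqP; rewrite eq_le; apply/andP; split;
  rewrite leNgt; apply/negP; rewrite -subr_gt0 => vUy.
- have [c [Oc dc hc]] := positive_max cd d_out vUy.
  have [d d0 dO] := open_eball oOmega Oc.
  have [T T0 hT] := exits_Omega c.
  (* The gap appears only beyond both radii: below [d] the two operators share the test function,
     and below [T] the line may still be in Omega. *)
  have dT0 : 0 < Num.max d T by rewrite lt_max d0.
  have touch w : eball c d w -> v w - phi0 w <= v c - phi0 c.
    by move=> yd; rewrite !phi0U//; exact: dO.
  have [/(_ Oc)+ _] := sub d phi0 c d0 hphi0 touch.
  rewrite sup_ext E_opE oppr_le0 => Ev.
  have [M1 hM1] := E_dir_bounded hs c d0 hphi0 cU UC'.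
  have [M2 hM2] := E_dir_bounded hs c d0 hphi0 cv vC'.
  have gap : 0 < 2 * (v c - U c) * kernel_tail s (Num.max d T).
    by rewrite mulr_gt0 ?kernel_tail_gt0//; lra.
  suff : sphere_functional p (fun z => E_dir s z d v phi0 c) +
      2 * (v c - U c) * kernel_tail s (Num.max d T) <=
      sphere_functional p (fun z => E_dir s z d U phi0 c).
    by rewrite U_solves//; lra.
  apply: (@sphere_functional_shift _ _ _ _ _ (M1 + M2)) => [//||z z1|z z1|z z1].
  + exact: ltW.
  + rewrite (le_trans (hM2 z z1))// lerDr.
    exact: le_trans (normr_ge0 _) (hM1 z z1).
  + rewrite (le_trans (hM1 z z1))// lerDl.
    exact: le_trans (normr_ge0 _) (hM2 z z1).
  apply: (@E_dir_compare _ _ _ hs _ _ _ _ _ _ _ _ C') => // t t0.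
  rewrite /spliced_diff ge_max.
  case: ifPn => td; first by rewrite leNgt td mulr0 addr0.
  have nt : `|t| = t by rewrite gtr0_norm.
  have h1 := hc (c + t *: z); have h2 := hc (c - t *: z).
  rewrite /second_diff leNgt td/=; case: ifPn => Tt; last by lra.
  have -> : v (c + t *: z) = U (c + t *: z) by apply/v_out/hT; rewrite ?nt.
  have -> : v (c - t *: z) = U (c - t *: z).
    by rewrite -scaleNr; apply/v_out/hT; rewrite ?normrN ?nt.
  lra.
- have [c [Oc dc hc]] := positive_max cd' d'_out vUy.
  have [d d0 dO] := open_eball oOmega Oc.
  have [T T0 hT] := exits_Omega c.
  have dT0 : 0 < Num.max d T by rewrite lt_max d0.
  have touch w : eball c d w -> v c - phi0 c <= v w - phi0 w.
    by move=> yd; rewrite !phi0U//; [have := hc w; lra|exact: dO].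
  have [/(_ Oc)+ _] := super d phi0 c d0 hphi0 touch.
  rewrite inf_ext E_opE oppr_ge0 => Ev.
  have [M1 hM1] := E_dir_bounded hs c d0 hphi0 cU UC'.
  have [M2 hM2] := E_dir_bounded hs c d0 hphi0 cv vC'.
  have gap : 0 < 2 * (U c - v c) * kernel_tail s (Num.max d T).
    by rewrite mulr_gt0 ?kernel_tail_gt0//; lra.
  suff : sphere_functional p (fun z => E_dir s z d U phi0 c) +
      2 * (U c - v c) * kernel_tail s (Num.max d T) <=
      sphere_functional p (fun z => E_dir s z d v phi0 c).
    by rewrite U_solves//; lra.
  apply: (@sphere_functional_shift _ _ _ _ _ (M1 + M2)) => [//||z z1|z z1|z z1].
  + exact: ltW.
  + rewrite (le_trans (hM1 z z1))// lerDl.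
    exact: le_trans (normr_ge0 _) (hM2 z z1).
  + rewrite (le_trans (hM2 z z1))// lerDr.
    exact: le_trans (normr_ge0 _) (hM1 z z1).
  apply: (@E_dir_compare _ _ _ hs _ _ _ _ _ _ _ _ C') => // t t0.
  rewrite /spliced_diff ge_max.
  case: ifPn => td; first by rewrite leNgt td mulr0 addr0.
  have nt : `|t| = t by rewrite gtr0_norm.
  have h1 := hc (c + t *: z); have h2 := hc (c - t *: z).
  rewrite /second_diff leNgt td/=; case: ifPn => Tt; last by lra.
  have -> : v (c + t *: z) = U (c + t *: z) by apply/v_out/hT; rewrite ?nt.
  have -> : v (c - t *: z) = U (c - t *: z).
    by rewrite -scaleNr; apply/v_out/hT; rewrite ?normrN ?nt.
  lra.
Qed.

Lemma classical_the_viscosity_solution : the_viscosity_solution p s Omega U U.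
Proof. by split; [exact: solution_self|exact: solution_unique]. Qed.

End ClassicalSolutions.

(** * Regularity of |x|^q, including at the origin *)

Section AbsolutePower.
Context {R : realType}.
Implicit Types (a b h q t x y : R).

(** Superadditivity of the power 1/q, applied to a^q and b^q. *)
Lemma powR_subadditive a b q : 0 <= a -> 0 <= b -> 0 < q < 1 ->
  (a + b) `^ q <= a `^ q + b `^ q.
Proof.
move=> a0 b0 /andP[q0 q1]; have q1' : 1 <= q^-1 by rewrite invf_ge1// ltW.
have := powR_superadditive (powR_ge0 a q) (powR_ge0 b q) q1'.
rewrite -!powRrM divff ?gt_eqF// !powRr1// => h.
have := @ge0_ler_powR R q (ltW q0) (a + b) ((a `^ q + b `^ q) `^ q^-1).
rewrite !nnegrE addr_ge0// powR_ge0 => /(_ isT isT h).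
by rewrite -powRrM mulVf ?gt_eqF// powRr1// addr_ge0// powR_ge0.
Qed.

Lemma abs_powR_holder x h q : 0 < q < 1 ->
  `| `|x + h| `^ q - `|x| `^ q| <= `|h| `^ q.
Proof.
move=> hq; have [q0 q1] := andP hq.
have le a b : `|a + b| `^ q <= `|a| `^ q + `|b| `^ q.
  apply: le_trans (powR_subadditive (normr_ge0 a) (normr_ge0 b) hq).
  by apply: ge0_ler_powR; rewrite ?nnegrE ?(ltW q0) ?addr_ge0// ler_normD.
have := le x h; have := le (x + h) (- h).
by rewrite addrK normrN ler_norml; lra.
Qed.

Lemma abs_powR_continuous q : 0 < q -> continuous (fun x : R => `|x| `^ q).
Proof.
move=> q0 x; have [->|x0] := eqVneq x 0; last first.
  apply: (continuous_comp (f := fun x : R => `|x|) (g := @powR R ^~ q)).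
    exact: norm_continuous.
  by apply: powR_continuous_at; rewrite normr_gt0.
apply/cvgrPdist_lt => e e0.
have eq0 : 0 < e `^ q^-1 by exact: powR_gt0.
near=> y; rewrite normr0 powR0 ?gt_eqF// sub0r normrN ger0_norm ?powR_ge0//.
have -> : e = (e `^ q^-1) `^ q.
  by rewrite -powRrM mulVf ?gt_eqF// powRr1// ltW.
rewrite gt0_ltr_powR ?nnegrE ?powR_ge0 ?normr_ge0 //.
Unshelve. all: by end_near. Qed.

Lemma is_derive_flat (g : R -> R) q : 1 < q ->
  (forall y, `|g y| <= `|y| `^ q) -> is_derive (0 : R) 1 g 0.
Proof.
move=> q1 gq.
have g0 : g 0 = 0.
  apply/eqP; rewrite -normr_le0; have := gq 0.
  by rewrite normr0 powR0// gt_eqF//; lra.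
suff c : h^-1 *: ((g \o shift 0) (h *: 1) - g 0) @[h --> 0^'] --> (0 : R).
  by split; [apply/cvg_ex; exists 0|exact/cvg_lim].
apply/cvgrPdist_lt => e e0.
have := @abs_powR_continuous (q - 1) ltac:(lra) 0.
move=> /cvgrPdist_lt/(_ e e0); rewrite normr0 powR0; last first.
  by rewrite gt_eqF//; lra.
move=> h0.
near=> h.
have hn0 : h != 0 by near: h; exact: nbhs_dnbhs_neq.
have hh : h *: (1 : R) = h by exact: mulr1.
rewrite sub0r normrN /= g0 subr0 addr0 hh.
rewrite /GRing.scale/= normrM normfV ltr_pdivrMl ?normr_gt0//.
apply: le_lt_trans (gq h) _.
have q10 : 0 < q by lra.
rewrite -(mulr_powRB1 (normr_ge0 h) q10) ltr_pM2l ?normr_gt0//.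
have : `|0 - `|h| `^ (q - 1)| < e by near: h; exact: nbhs_dnbhs.
by rewrite sub0r normrN ger0_norm// powR_ge0.
Unshelve. all: by end_near. Qed.

Lemma is_derive_abs_powR_neq0 q x : x != 0 ->
  is_derive x 1 (fun y : R => `|y| `^ q) (q * (x * `|x| `^ (q - 2))).
Proof.
move=> xn0.
have pos (z : R) : 0 < z ->
    is_derive z 1 (fun y : R => `|y| `^ q) (q * (z * `|z| `^ (q - 2))).
  move=> z0; rewrite gtr0_norm// (_ : z * _ = z `^ (q - 1)); last first.
    rewrite -{1}(powRr1 (ltW z0)) -powRD ?(gt_eqF z0) ?implybT//.
    by congr (_ `^ _); lra.
  apply: near_eq_is_derive (is_derive1_powR q z0).
  near=> y; rewrite gtr0_norm//; near: y; exact: lt_nbhsr.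
have [x0|x0] := ltP 0 x; first exact: pos.
have {}x0 : 0 < - x by rewrite oppr_gt0 lt_neqAle xn0.
have dN : is_derive x 1 (-%R : R -> R) (-1) by exact: is_deriveNid.
have := @is_derive1_comp _ (fun y : R => `|y| `^ q) -%R x _ _ (pos _ x0) dN.
rewrite (_ : _ \o _ = fun y : R => `|y| `^ q); last first.
  by apply/funext => y /=; rewrite normrN.
by rewrite normrN mulrN1 mulNr mulrN opprK.
Unshelve. all: by end_near. Qed.

Lemma is_derive_abs_powR q x : 1 < q ->
  is_derive x 1 (fun y : R => `|y| `^ q) (q * (x * `|x| `^ (q - 2))).
Proof.
move=> q1; have [->|xn0] := eqVneq x 0; last exact: is_derive_abs_powR_neq0.
rewrite mul0r mulr0; apply: (is_derive_flat q1) => y.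
by rewrite ger0_norm ?powR_ge0.
Qed.

Lemma is_derive_mul_abs_powR q x : 0 < q ->
  is_derive x 1 (fun y : R => y * `|y| `^ q) ((1 + q) * `|x| `^ q).
Proof.
move=> q0; have [->|xn0] := eqVneq x 0.
  rewrite normr0 powR0 ?gt_eqF// mulr0.
  apply: (@is_derive_flat _ (q + 1)); first lra.
  move=> y; rewrite normrM (ger0_norm (powR_ge0 _ _)).
  have := @mulr_powRB1 R `|y| (q + 1) (normr_ge0 y) ltac:(lra).
  by rewrite addrK => ->.
have := @is_deriveM _ _ id (fun y : R => `|y| `^ q) x 1 _ _
  (is_derive_id x 1) (is_derive_abs_powR_neq0 q xn0).
rewrite /GRing.scale/= mulr1 => /is_derive_eq; apply.
have x0 : 0 < `|x| by rewrite normr_gt0.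
have -> : `|x| `^ q = x * x * `|x| `^ (q - 2).
  rewrite -expr2 -(real_normK (num_real x)) -powR_mulrn//.
  rewrite -powRD ?(gt_eqF x0) ?implybT//; congr (_ `^ _); lra.
ring.
Qed.

Lemma MVT_bound (g g1 : R -> R) M x y : (forall t, is_derive t 1 g (g1 t)) ->
  (forall t, `|g1 t| <= M) -> `|g y - g x| <= M * `|y - x|.
Proof.
move=> dg g1M.
have le a b : a <= b -> `|g b - g a| <= M * `|b - a|.
  move=> ab; have gc : {within `[a, b], continuous g}.
    apply: derivable_within_continuous => t _.
    exact: (@ex_derive _ _ _ _ _ _ _ (dg t)).
  have [c _ ->] := MVT_segment ab (fun t _ => dg t) gc.
  by rewrite normrM ler_wpM2r.
have [xy|/ltW yx] := leP x y; first exact: le.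
by rewrite distrC [`|y - x|]distrC; exact: le.
Qed.

Definition forward_diff h (g : R -> R) : R -> R := fun y => g (y + h) - g y.

Lemma is_derive_forward_diff h (g g1 : R -> R) :
  (forall x, is_derive x 1 g (g1 x)) ->
  forall x, is_derive x 1 (forward_diff h g) (forward_diff h g1 x).
Proof.
move=> dg x; apply: is_deriveB.
have d1 : is_derive x 1 (fun y : R => y + h) 1.
  have := is_deriveD (is_derive_id x (1 : R)) (is_derive_cst h x (1 : R)).
  by rewrite addr0.
have := @is_derive1_comp _ g (fun y : R => y + h) x _ _ (dg _) d1.
by rewrite mulr1.
Qed.

Lemma continuous_forward_diff h (g : R -> R) : continuous g ->
  continuous (forward_diff h g).
Proof.
move=> cg x; apply: continuousB; last exact: cg.
apply: (continuous_comp (f := fun y : R => y + h) (g := g)); last exact: cg.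
by apply: continuousD; [exact: cvg_id|exact: cvg_cst].
Qed.

End AbsolutePower.

(** * The one-dimensional profile and its line operator *)

Section Profile.
Context {R : realType}.
Local Notation mu := (@lebesgue_measure R).
Variable p : R.
Hypothesis hp : 2 < p < 3.
Implicit Types (y zeta t h : R) (g G : R -> R).

Let p2 : 2 < p. Proof. by case/andP: hp. Qed.
Let p3 : p < 3. Proof. by case/andP: hp. Qed.
Let p0 : 0 < p. Proof. exact: lt_trans p2. Qed.

(** The second difference of |x|^p at the point 1 with the part 2 |t|^p, which diverges after
    division by t^p, taken away. *)
Definition clarkson t := `|1 + t| `^ p + `|1 - t| `^ p - 2 - 2 * `|t| `^ p.

Lemma clarkson_ge0 t : 0 <= clarkson t.
Proof.
have := clarkson_le (ltW p2) (normr_ge0 t); rewrite /clarkson.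
by have [t0|t0] := leP 0 t; rewrite ?(ger0_norm t0) ?(ltr0_norm t0) ?opprK; lra.
Qed.

Lemma measurable_abs_powR (a : R) (b : R) :
  measurable_fun [set: R] (fun t => `|a + b * t| `^ p).
Proof.
apply: continuous_measurable_fun => t.
apply: (continuous_comp (f := fun t : R => a + b * t)
  (g := fun x : R => `|x| `^ p)).
  apply: continuousD; first exact: cvg_cst.
  exact: mulrl_continuous.
exact: abs_powR_continuous.
Qed.

Lemma measurable_clarkson : measurable_fun [set: R] clarkson.
Proof.
apply: measurable_funB; last first.
  apply: measurable_funM => //; have := measurable_abs_powR 0 1.
  by under eq_fun do rewrite add0r mul1r.
apply: measurable_funB => //; apply: measurable_funD.
  by have := measurable_abs_powR 1 1; under eq_fun do rewrite mul1r.
by have := measurable_abs_powR 1 (-1); under eq_fun do rewrite mulN1r.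
Qed.

Lemma integrable_clarkson :
  mu.-integrable `]0, +oo[ (EFin \o (fun t => clarkson t / t `^ p)).
Proof.
apply: (@integrable_kernel _ _ 6) => //; first exact: measurable_clarkson.
  move=> t /andP[t0 t1]; rewrite ger0_norm ?clarkson_ge0//.
  have h : 0 <= t <= 1 by rewrite ltW.
  have := second_difference_powR_le1 hp h; have := powR_ge0 `|t| p.
  by rewrite /clarkson; lra.
move=> t t1; rewrite ger0_norm ?clarkson_ge0//.
have := second_difference_powR_ge1 hp t1.
rewrite /clarkson (ger0_norm (_ : 0 <= t)); lra.
Qed.

Definition clarkson_constant := \int[mu]_(t in `]0, +oo[) (clarkson t / t `^ p).

Lemma clarkson_constant_gt0 : 0 < clarkson_constant.
Proof.
pose s := (p - 1) / 2.
have ps : p = 1 + 2 * s by rewrite /s; field.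
have hs : 2^-1 < s < 1.
  by have := p2; have := p3; rewrite /s => ? ?; apply/andP; lra.
(* The gap in Clarkson's inequality for t >= 1; the integral over that half-line already bounds the
   constant away from 0. *)
pose c := 2 * (2 `^ (p / 2 - 1) - 1) : R.
have c0 : 0 < c.
  rewrite mulr_gt0// subr_gt0 -[ltLHS](powRr0 2); have := p2 => p2'.
  by rewrite /powR pnatr_eq0/= ltr_expR ltr_pM2r ?ln_gt0 ?ltr1n//; lra.
apply: lt_le_trans (mulr_gt0 c0 (kernel_tail_gt0 hs ltr01)) _.
have i1 := kernel_tail_integrable hs (ltr01 : 0 < 1 :> R).
rewrite /kernel_tail -RintegralZl//; apply: le_Rintegral => //.
- exact: integrable_scale.
- exact: integrable_clarkson.
move=> t /=; rewrite in_itv/= andbT => t0.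
rewrite mulrA -ps ler_wpM2r ?invr_ge0 ?powR_ge0//.
case: ifPn => t1; last by rewrite mulr0 clarkson_ge0.
have := clarkson_gap_ge1 p2 t1.
by rewrite mulr1 /clarkson (ger0_norm (ltW t0)).
Qed.

Definition line_diff g y zeta t :=
  g (y + t * zeta) + g (y - t * zeta) - 2 * g y.

(* [m] subtracts the part of the integrand that diverges at infinity: [m = 1]
   for [|x| ^ p], and [m = 0] for its differences. *)
Definition has_line_operator m g G := forall y zeta,
  mu.-integrable `]0, +oo[ (EFin \o (fun t =>
    (line_diff g y zeta t - m * (2 * `|t * zeta| `^ p)) / t `^ p)) /\
  \int[mu]_(t in `]0, +oo[)
    ((line_diff g y zeta t - m * (2 * `|t * zeta| `^ p)) / t `^ p) =
  G y * `|zeta| `^ (p - 1).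

(** The substitution t -> c t with c = |zeta| / |y| normalizes the point and the direction to 1. The
    factor |zeta|^p from the quotient and 1/c from the measure combine to |y| |zeta|^(p - 1). *)
Lemma has_line_operator_abs_powR :
  has_line_operator 1 (fun x => `|x| `^ p) (fun y => clarkson_constant * `|y|).
Proof.
move=> y zeta; rewrite /line_diff.
pose q t := (`|y + t * zeta| `^ p + `|y - t * zeta| `^ p - 2 * `|y| `^ p -
  1 * (2 * `|t * zeta| `^ p)) / t `^ p.
have zero : (forall t, 0 < t -> q t = 0) ->
    clarkson_constant * `|y| * `|zeta| `^ (p - 1) = 0 ->
    mu.-integrable `]0, +oo[ (EFin \o q) /\
    \int[mu]_(t in `]0, +oo[) q t =
    clarkson_constant * `|y| * `|zeta| `^ (p - 1).
  move=> f0 ->; split.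
    apply: (@eq_integrable _ _ _ mu _ (measurable_itv _) (EFin \o cst 0)) => //.
      by move=> t; rewrite inE/= in_itv/= andbT => /f0 ->.
    exact: integrable0.
  rewrite (@eq_Rintegral _ _ _ mu _ (cst 0)); last first.
    by move=> t; rewrite inE/= in_itv/= andbT => /f0 ->.
  by rewrite Rintegral_cst// mul0r.
have [y0|y0] := eqVneq y 0.
  apply: zero => [t _|]; last by rewrite y0 normr0 mulr0 mul0r.
  rewrite /q y0 add0r sub0r normrN normr0 powR0 ?(gt_eqF p0)//.
  by rewrite (_ : _ - _ = 0) ?mul0r//; ring.
have [z0|z0] := eqVneq zeta 0.
  apply: zero => [t _|].
    rewrite /q z0 mulr0 addr0 subr0 normr0 powR0 ?(gt_eqF p0)//.
    by rewrite (_ : _ - _ = 0) ?mul0r//; ring.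
  rewrite z0 normr0 powR0 ?mulr0// gt_eqF// subr_gt0 (lt_trans _ p2)//.
  by rewrite ltr1n.
have ny : 0 < `|y| by rewrite normr_gt0.
have nz : 0 < `|zeta| by rewrite normr_gt0.
pose c := `|zeta| / `|y|.
have c0 : 0 < c by rewrite divr_gt0.
have fE t : 0 < t ->
    q t = `|zeta| `^ p * (clarkson (c * t) / (c * t) `^ p).
  move=> t0; rewrite /q /clarkson powRM ?(ltW c0) ?(ltW t0)//.
  have ct0 : 0 <= c * t by rewrite mulr_ge0 ?ltW.
  have tz : `|t * zeta| = `|y| * `|c * t|.
    rewrite normrM (gtr0_norm t0) (ger0_norm ct0) /c; field.
    by rewrite gt_eqF.
  have sym : `|y + t * zeta| `^ p + `|y - t * zeta| `^ p =
      `|y| `^ p * (`|1 + c * t| `^ p + `|1 - c * t| `^ p).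
    (* The signs of [y] and [zeta] only decide which of the two symmetric terms is which. *)
    have [e|e] : y * (c * t) = t * zeta \/ y * (c * t) = - (t * zeta).
      have : `|t * zeta| == `|y * (c * t)| by rewrite tz (normrM y).
      by rewrite eqr_norm2 => /orP[]/eqP ->; [left|right; rewrite opprK].
    - rewrite mulrDr -!powRM// -!normrM mulrDr mulrBr mulr1 e//.
    - rewrite mulrDr -!powRM// -!normrM mulrDr mulrBr mulr1 e opprK//.
      by rewrite addrC.
  have cp : c `^ p = `|zeta| `^ p / `|y| `^ p.
    by rewrite /c powRM ?invr_ge0// -(powR_inv1 (ltW ny)) -powRrM mulN1r powRN.
  rewrite sym tz powRM// cp.
  have := powR_gt0 p ny; have := powR_gt0 p nz; have := powR_gt0 p t0.
  move: (`|y| `^ p) (`|zeta| `^ p) (t `^ p) => Y Z T T0 Z0 Y0.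
  by field; rewrite !gt_eqF.
pose H t := clarkson t / t `^ p.
have H0 t : 0 <= H t by rewrite /H divr_ge0 ?clarkson_ge0 ?powR_ge0.
have mH : measurable_fun [set: R] H.
  apply: measurable_funM; first exact: measurable_clarkson.
  exact: measurable_inv_powR.
have mHc : measurable_fun [set: R] (fun t => H (c * t)).
  by apply: measurableT_comp => //; exact: mulrl_measurable.
have scaleE := @ge0_integral_scale R c (EFin \o H) c0
  (iffRL (measurable_EFinP _ _) mH) (fun t => H0 t).
have iH : mu.-integrable `]0, +oo[ (EFin \o H) by exact: integrable_clarkson.
have cN0 : (c%:E != 0)%E by rewrite eqe gt_eqF.
have iHc : mu.-integrable `]0, +oo[ (EFin \o (fun t => H (c * t))).
  apply/integrableP; split; first exact/measurable_EFinP/measurable_funTS.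
  case/integrableP: iH => _.
  under eq_integral do rewrite /= ger0_norm//.
  under [X in _ -> (X < _)%E]eq_integral do rewrite /= ger0_norm//.
  rewrite [X in (X < _)%E -> _]scaleE /comp.
  move=> h; rewrite ltey; apply/eqP => e; move: h.
  by rewrite e gt0_muley ?ltxx// lte_fin.
have iF : mu.-integrable `]0, +oo[
    (EFin \o (fun t => `|zeta| `^ p * (clarkson (c * t) / (c * t) `^ p))).
  exact: integrable_scale iHc.
split.
  apply: eq_integrable iF => // t; rewrite inE/= in_itv/= andbT => t0.
  by rewrite -(fE t t0).
rewrite (@eq_Rintegral _ _ _ mu _
  (fun t => `|zeta| `^ p * (clarkson (c * t) / (c * t) `^ p))); last first.
  by move=> t; rewrite inE/= in_itv/= andbT => /fE.
rewrite RintegralZl//.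
have -> : clarkson_constant = c * \int[mu]_(t in `]0, +oo[) (H (c * t)).
  rewrite /clarkson_constant /Rintegral scaleE fineM//.
  exact: integrable_fin_num iHc.
rewrite -/(H _) -(@mulr_powRB1 _ `|zeta| p)// /c.
by field; rewrite gt_eqF.
Qed.

(** The operator is linear and commutes with translations; the subtracted divergent term does not
    depend on the point, so it cancels. *)
Lemma has_line_operator_forward_diff m h g G : has_line_operator m g G ->
  has_line_operator 0 (forward_diff h g) (forward_diff h G).
Proof.
move=> gG y zeta; have [i1 E1] := gG (y + h) zeta; have [i2 E2] := gG y zeta.
have fE t : (line_diff (forward_diff h g) y zeta t -
      0 * (2 * `|t * zeta| `^ p)) / t `^ p =
    (line_diff g (y + h) zeta t - m * (2 * `|t * zeta| `^ p)) / t `^ p -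
    (line_diff g y zeta t - m * (2 * `|t * zeta| `^ p)) / t `^ p.
  rewrite -mulrBl; congr (_ / _); rewrite /line_diff /forward_diff.
  by rewrite (addrAC y (t * zeta)) (addrAC y (- (t * zeta))); ring.
split.
  rewrite (_ : (fun t => _) = fun t =>
    (line_diff g (y + h) zeta t - m * (2 * `|t * zeta| `^ p)) / t `^ p -
    (line_diff g y zeta t - m * (2 * `|t * zeta| `^ p)) / t `^ p).
    exact: (@integrableB _ _ _ mu _ (measurable_itv _) _ _ i1 i2).
  by apply/funext => t; exact: fE.
under eq_Rintegral do rewrite fE.
by rewrite RintegralB// E1 E2 /forward_diff mulrBl.
Qed.

(* The [|x|] in place of [|x| ^ p] would give the constant [- 2 r] for
   [- r <= y <= r]. *)
Definition spline (r : R) : R -> R := fun y =>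
  forward_diff (3 * r) (forward_diff (3 * r) (forward_diff r
    (fun x => `|x| `^ p))) (y - 2 * r).

Lemma spline_line_operator r y zeta : 0 < r -> `|y| <= r ->
  mu.-integrable `]0, +oo[
    (EFin \o (fun t => line_diff (spline r) y zeta t / t `^ p)) /\
  \int[mu]_(t in `]0, +oo[) (line_diff (spline r) y zeta t / t `^ p) =
  - (2 * r * clarkson_constant) * `|zeta| `^ (p - 1).
Proof.
move=> r0; rewrite ler_norml => /andP[yl yr].
have := has_line_operator_abs_powR.
move=> /(@has_line_operator_forward_diff _ r).
move=> /(@has_line_operator_forward_diff _ (3 * r)).
move=> /(@has_line_operator_forward_diff _ (3 * r)).
move=> /(_ (y - 2 * r) zeta) [i E].
have fE t : (line_diff (forward_diff (3 * r) (forward_diff (3 * r)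
    (forward_diff r (fun x => `|x| `^ p)))) (y - 2 * r) zeta t -
      0 * (2 * `|t * zeta| `^ p)) / t `^ p =
    line_diff (spline r) y zeta t / t `^ p.
  rewrite mul0r subr0 /line_diff /spline.
  by rewrite (addrAC y (t * zeta)) (addrAC y (- (t * zeta))).
split.
  move: i; congr (is_true _); congr (_.-integrable _ _).
  by apply/funext => t /=; rewrite fE.
move: E; under eq_Rintegral do rewrite fE.
move=> ->; congr (_ * _); rewrite /forward_diff.
(* For |y| <= r no node of the third difference changes sign. The three pairs of nodes at distance
   [r], with weights 1, -2, 1, contribute r, - 2 r and - r. *)
rewrite (ger0_norm (_ : 0 <= y - 2 * r + 3 * r + 3 * r + r)); last lra.
rewrite (ger0_norm (_ : 0 <= y - 2 * r + 3 * r + 3 * r)); last lra.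
rewrite (ger0_norm (_ : 0 <= y - 2 * r + 3 * r + r)); last lra.
rewrite (ger0_norm (_ : 0 <= y - 2 * r + 3 * r)); last lra.
rewrite (ler0_norm (_ : y - 2 * r + r <= 0)); last lra.
rewrite (ler0_norm (_ : y - 2 * r <= 0)); last lra.
ring.
Qed.

(** For the bound, the first difference acts on the second derivative, by Hoelder continuity of
    |y|^(p - 2); the mean value theorem then trades each further difference for one derivative. *)
Lemma spline_derivatives r : exists a1 a2 : R -> R,
  [/\ forall y, is_derive y 1 (spline r) (a1 y),
      forall y, is_derive y 1 a1 (a2 y), continuous a2 &
      exists C, forall y, `|spline r y| <= C].
Proof.
have p1 : 1 < p by have := p2; lra.
have q01 : 0 < p - 2 < 1 by have := p2; have := p3; move=> ? ?; apply/andP; lra.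
have q0 : 0 < p - 2 by case/andP: q01.
pose f1 y : R := p * (y * `|y| `^ (p - 2)).
pose f2 y : R := p * ((1 + (p - 2)) * `|y| `^ (p - 2)).
have d0 y : is_derive y 1 (fun x : R => `|x| `^ p) (f1 y).
  exact: is_derive_abs_powR.
have d1 y : is_derive y 1 f1 (f2 y).
  have := @is_deriveZ _ _ _ (fun y : R => y * `|y| `^ (p - 2)) p y 1 _
    (is_derive_mul_abs_powR y q0).
  exact.
have c2 : continuous f2.
  move=> y; apply: cvgMl_tmp; apply: cvgMl_tmp; exact: abs_powR_continuous.
pose D3 g := forward_diff (3 * r) (forward_diff (3 * r) (forward_diff r g)).
have shift (g g1 : R -> R) : (forall y, is_derive y 1 g (g1 y)) ->
    forall y, is_derive y 1 (fun y => g (y - 2 * r)) (g1 (y - 2 * r)).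
  move=> dg y.
  have e : is_derive y 1 (fun y : R => y - 2 * r) 1.
    have := is_deriveB (is_derive_id y (1 : R)) (is_derive_cst (2 * r) y (1 : R)).
    by rewrite subr0.
  have := @is_derive1_comp _ g (fun y : R => y - 2 * r) y _ _ (dg _) e.
  by rewrite mulr1.
exists (fun y => D3 f1 (y - 2 * r)), (fun y => D3 f2 (y - 2 * r)); split.
- by apply: shift; do 3 apply: is_derive_forward_diff.
- by apply: shift; do 3 apply: is_derive_forward_diff.
- move=> y; apply: (continuous_comp (f := fun y : R => y - 2 * r) (g := D3 f2)).
    by apply: continuousB; [exact: cvg_id|exact: cvg_cst].
  by do 3 apply: continuous_forward_diff.
have b1 : exists M, forall y, `|forward_diff r f2 y| <= M.
  exists (p * (1 + (p - 2)) * `|r| `^ (p - 2)) => y.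
  rewrite /forward_diff /f2 -!mulrBr !normrM mulrA.
  have pp : 0 <= p by exact: ltW.
  have qq : 0 <= 1 + (p - 2) by lra.
  rewrite (ger0_norm pp) (ger0_norm qq) ler_wpM2l ?mulr_ge0//.
  exact: abs_powR_holder.
have [M1 hM1] := b1.
have hM2 y : `|forward_diff (3 * r) (forward_diff r f1) y| <= M1 * `|3 * r|.
  rewrite {1}/forward_diff.
  apply: le_trans (MVT_bound y (y + 3 * r) (is_derive_forward_diff r d1) hM1) _.
  by rewrite addrC addKr.
exists (M1 * `|3 * r| * `|3 * r|) => y; rewrite /spline {1}/forward_diff.
apply: le_trans (MVT_bound (y - 2 * r) (y - 2 * r + 3 * r)
  (is_derive_forward_diff (3 * r) (is_derive_forward_diff r d0)) hM2) _.
by rewrite [_ + 3 * r]addrC addrK.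
Qed.

End Profile.

Lemma continuous_scale (R : realType) (T : topologicalType) (c : R)
    (f : T -> R) x :
  {for x, continuous f} -> {for x, continuous (fun y => c * f y)}.
Proof.
by move=> cf; apply: (@continuousM _ _ (fun=> c) f); [exact: cst_continuous|].
Qed.

(** * Smoothness of functions of a single coordinate *)

Section CoordinateFunctions.
Context {R : realType} {N : nat}.
Implicit Types (f : 'rV[R]_N -> R) (g : R -> R) (x : 'rV[R]_N) (i j : 'I_N).

Lemma is_derive_coord g g1 i j x : (forall y : R, is_derive y 1 g (g1 y)) ->
  is_derive x (delta_mx 0 j) (fun x => g (x 0 i)) ((j == i)%:R * g1 (x 0 i)).
Proof.
move=> dg; have [ji|ji] := eqVneq j i; last first.
  rewrite mul0r.
  have E : (fun h : R => h^-1 *: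
      (((fun x => g (x 0 i)) \o shift x) (h *: delta_mx 0 j) - g (x 0 i))) = fun=> 0.
    apply/funext => h /=; rewrite !mxE/= eq_sym (negbTE ji) mulr0 add0r subrr.
    by rewrite scaler0.
  split; rewrite /derivable /derive E; first exact: is_cvg_cst.
  by apply: cvg_lim => //; exact: cvg_cst.
rewrite mul1r ji.
have E : (fun h : R => h^-1 *:
      (((fun x => g (x 0 i)) \o shift x) (h *: delta_mx 0 i) - g (x 0 i))) =
    (fun h : R => h^-1 *: ((g \o shift (x 0 i)) (h *: (1 : R)) - g (x 0 i))).
  by apply/funext => h /=; rewrite !mxE/= eqxx.
have [d1 d2] := dg (x 0 i).
split; first by rewrite /derivable E.
by rewrite /derive E.
Qed.

Lemma C1_coord g g1 i : (forall y : R, is_derive y 1 g (g1 y)) ->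
  continuous g1 -> C1 (fun x => g (x 0 i)).
Proof.
move=> dg cg1 j; split=> [x|].
  exact: (@ex_derive _ _ _ _ _ _ _ (is_derive_coord i j x dg)).
have -> : 'D_(delta_mx 0 j) (fun x => g (x 0 i)) =
    fun x => (j == i)%:R * g1 (x 0 i).
  apply/funext => x.
  exact: (@derive_val _ _ _ _ _ _ _ (is_derive_coord i j x dg)).
move=> x.
apply: continuous_scale.
apply: (continuous_comp (f := fun x : 'rV[R]_N => x 0 i) (g := g1)).
  exact: coord_continuous.
exact: cg1.
Qed.

Lemma C2_coord g g1 g2 i : (forall y : R, is_derive y 1 g (g1 y)) ->
  (forall y : R, is_derive y 1 g1 (g2 y)) -> continuous g2 ->
  C2 (fun x => g (x 0 i)).
Proof.
move=> dg dg1 cg2.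
have cg1 : continuous g1.
  move=> y; apply: differentiable_continuous; apply/derivable1_diffP.
  exact: (@ex_derive _ _ _ _ _ _ _ (dg1 y)).
split=> [|j]; first exact: C1_coord dg cg1.
have -> : 'D_(delta_mx 0 j) (fun x => g (x 0 i)) =
    fun x => (fun y => (j == i)%:R * g1 y) (x 0 i).
  apply/funext => x.
  exact: (@derive_val _ _ _ _ _ _ _ (is_derive_coord i j x dg)).
apply: (@C1_coord (fun y => (j == i)%:R * g1 y)
  (fun y => (j == i)%:R * g2 y)) => y.
by apply: continuous_scale; exact: cg2.
Qed.

Lemma C1_sub f1 f2 : C1 f1 -> C1 f2 -> C1 (fun x => f1 x - f2 x).
Proof.
move=> h1 h2 i; have [d1 c1] := h1 i; have [d2 c2] := h2 i.
split=> [x|]; first exact: derivableB.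
have -> : 'D_(delta_mx 0 i) (fun x => f1 x - f2 x) =
    fun x => 'D_(delta_mx 0 i) f1 x - 'D_(delta_mx 0 i) f2 x.
  by apply/funext => x; exact: deriveB.
move=> x; apply: (@continuousB _ _ _
  ('D_(delta_mx 0 i) f1) ('D_(delta_mx 0 i) f2)).
  exact: c1.
exact: c2.
Qed.

Lemma C2_sub f1 f2 : C2 f1 -> C2 f2 -> C2 (fun x => f1 x - f2 x).
Proof.
move=> [h1 k1] [h2 k2]; split=> [|i]; first exact: C1_sub.
have -> : 'D_(delta_mx 0 i) (fun x => f1 x - f2 x) =
    fun x => 'D_(delta_mx 0 i) f1 x - 'D_(delta_mx 0 i) f2 x.
  by apply/funext => x; apply: deriveB; [exact: (h1 i).1|exact: (h2 i).1].
by apply: C1_sub; [exact: k1|exact: k2].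
Qed.

Lemma C2_cst (c : R) : C2 (fun _ : 'rV[R]_N => c).
Proof.
have c1 (d : R) : C1 (fun _ : 'rV[R]_N => d).
  move=> i; split=> [x|]; first exact: derivable_cst.
  have -> : 'D_(delta_mx 0 i) (fun _ : 'rV[R]_N => d) = fun=> 0.
    by apply/funext => x; exact: derive_cst.
  exact: cst_continuous.
split=> [|i]; first exact: c1.
have -> : 'D_(delta_mx 0 i) (fun _ : 'rV[R]_N => c) = fun=> 0.
  by apply/funext => x; exact: derive_cst.
exact: c1.
Qed.

End CoordinateFunctions.

(** * The saddle, the distant bump, and the equation for their sum *)

Section Construction.
Context {R : realType} {N : nat}.
Local Notation mu := (@lebesgue_measure R).
Variables (s r : R) (i0 i1 : 'I_N).
Hypotheses (hs : 2^-1 < s < 1) (r0 : 0 < r) (i01 : i0 != i1).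
Implicit Types (x y z : 'rV[R]_N) (t eta delta : R).

Local Notation p := (1 + 2 * s).
Local Notation hp := (exponent_bounds hs).

Definition saddle x : R := spline p r (x 0 i1) - spline p r (x 0 i0).

(** Seen from the cube of half-side [r], every point within sup distance 1 has displacements
    strictly between 3 (1 + r) and 5 (1 + r) in both coordinates. Their ratio is below 2, and each
    exceeds 1, which keeps the bump at distance at least 1 along any line. *)
Definition far_point : 'rV[R]_N :=
  \row_j (if (j == i0) || (j == i1) then 4 * (1 + r) else 0).

Definition tent x : R := Num.max 0 (1 - `|x - far_point|).

Definition bumped_saddle eta x : R := saddle x + eta * tent x.

Definition kappa : R := 2 * r * clarkson_constant p.

Lemma kappa_gt0 : 0 < kappa.
Proof. by rewrite mulr_gt0 ?clarkson_constant_gt0 ?hp// mulr_gt0. Qed.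

Lemma C2_saddle : C2 saddle.
Proof.
have [a1 [a2 [d1 d2 c2 _]]] := spline_derivatives hp r.
by apply: C2_sub; apply: C2_coord d1 d2 c2.
Qed.

Lemma saddle_bounded : exists C, forall x, `|saddle x| <= C.
Proof.
have [a1 [a2 [_ _ _ [C hC]]]] := spline_derivatives hp r.
exists (C + C) => x; apply: le_trans (ler_normB _ _) _.
by rewrite lerD.
Qed.

Lemma tent_continuous : continuous tent.
Proof.
move=> x; apply: continuous_normP => e e0; exists e => // y yx.
have h : `|(`|y - far_point| - `|x - far_point|)| <= `|y - x|.
  apply: le_trans (ler_dist_dist _ _) _.
  by rewrite opprB addrA subrK.
apply: le_lt_trans yx; apply: le_trans h; rewrite /tent.
move: (`|y - _|) (`|x - far_point|) => a b.
have [a1|a1] := leP 0 (1 - a); have [b1|b1] := leP 0 (1 - b);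
  rewrite ler_norml; have h1 := ler_norm (a - b); have h2 := ler_norm (b - a);
  rewrite distrC in h2; lra.
Qed.

Lemma tent_ge0 x : 0 <= tent x. Proof. by rewrite le_max lexx. Qed.

Lemma tent_le1 x : tent x <= 1.
Proof. by rewrite ge_max ler01/= gerBl. Qed.

Lemma tent_near x : tent x != 0 -> `|x - far_point| < 1.
Proof.
apply: contra_neqT; rewrite -leNgt => h.
by apply/max_idPl; rewrite subr_le0.
Qed.

Lemma tent_near_coord x i : tent x != 0 -> (i == i0) || (i == i1) ->
  `|x 0 i - 4 * (1 + r)| < 1.
Proof.
move=> /tent_near h ii; apply: le_lt_trans h.
by have := coord_le_norm (x - far_point) i; rewrite !mxE ii.
Qed.

Lemma tent_eq0 x : `|x| <= r -> tent x = 0.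
Proof.
move=> xr; apply/eqP; apply/negPn/negP => b0.
have h : (i0 == i0) || (i0 == i1) by rewrite eqxx.
have := tent_near_coord b0 h; have := le_trans (coord_le_norm x i0) xr.
by rewrite ler_norml ltr_norml; have := r0; lra.
Qed.

(* A line through the cube of half-side [r] can only meet the tent far away
   and in a direction close to the diagonal. *)
Lemma tent_line x z t : `|x| <= r -> enorm z = 1 -> tent (x + t *: z) != 0 ->
  [/\ 1 <= `|t|, z 0 i0 != 0, z 0 i1 != 0 & `|z 0 i0| <= 2 * `|z 0 i1|].
Proof.
move=> xr z1 b0.
have x0 := le_trans (coord_le_norm x i0) xr.
have x1 := le_trans (coord_le_norm x i1) xr.
have e0 : (i0 == i0) || (i0 == i1) by rewrite eqxx.
have e1 : (i1 == i0) || (i1 == i1) by rewrite eqxx orbT.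
have h0 := tent_near_coord b0 e0; have h1 := tent_near_coord b0 e1.
rewrite !mxE in h0 h1.
move: x0 x1 h0 h1; rewrite !ler_norml !ltr_norml => x0 x1 h0 h1.
have rr := r0.
have k0 : 3 * (1 + r) < t * z 0 i0 < 5 * (1 + r) by apply/andP; lra.
have k1 : 3 * (1 + r) < t * z 0 i1 < 5 * (1 + r) by apply/andP; lra.
have n0 : `|t| * `|z 0 i0| = t * z 0 i0 by rewrite -normrM ger0_norm; lra.
have n1 : `|t| * `|z 0 i1| = t * z 0 i1 by rewrite -normrM ger0_norm; lra.
have zz : `|z 0 i0| <= 1.
  by rewrite -z1 (le_trans (coord_le_norm _ _))// norm_le_enorm.
have tn := normr_ge0 t.
split.
- rewrite leNgt; apply/negP => t1.
  have : `|t| * `|z 0 i0| <= 1 by rewrite mulr_ile1// ltW.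
  by rewrite n0; lra.
- by apply/eqP => e; rewrite e mulr0 in k0; lra.
- by apply/eqP => e; rewrite e mulr0 in k1; lra.
have t0 : 0 < `|t|.
  by rewrite normr_gt0; apply/eqP => e; rewrite e mul0r in k0; lra.
have : `|t| * `|z 0 i0| <= `|t| * (2 * `|z 0 i1|).
  by rewrite n0 (mulrCA `|t|) n1; lra.
by rewrite (ler_pM2l t0) ler_norml.
Qed.

Lemma bumped_saddle_continuous eta : continuous (bumped_saddle eta).
Proof.
move=> x; apply: (@continuousD _ _ _ saddle (fun y => eta * tent y)).
  by apply: C1_continuous; case: C2_saddle.
by apply: continuous_scale; exact: tent_continuous.
Qed.

Lemma bumped_saddle_bounded eta : 0 <= eta ->
  exists C, forall x, `|bumped_saddle eta x| <= C.
Proof.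
move=> e0; have [C hC] := saddle_bounded; exists (C + eta) => x.
apply: le_trans (ler_normD _ _) (lerD (hC x) _).
rewrite ger0_norm ?mulr_ge0 ?tent_ge0//.
by rewrite ler_piMr// tent_le1.
Qed.

Definition tent_integral x z :=
  \int[mu]_(t in `]0, +oo[) (second_diff tent x z t / t `^ p).

Lemma tent_integralN x z : tent_integral x (- z) = tent_integral x z.
Proof.
rewrite /tent_integral; under eq_Rintegral => t _.
  rewrite /second_diff scalerN opprK [tent _ + _]addrC; over.
by [].
Qed.

Lemma second_diff_tent x z t : `|x| <= r -> enorm z = 1 -> 0 < t ->
  0 <= second_diff tent x z t <= 2 * (if 1 <= t then 1 else 0).
Proof.
move=> xr z1 t0; rewrite /second_diff (tent_eq0 xr) mulr0 subr0.
have bp := tent_ge0 (x + t *: z); have bm := tent_ge0 (x - t *: z).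
rewrite addr_ge0//=; case: ifPn => t1.
  by have := tent_le1 (x + t *: z); have := tent_le1 (x - t *: z); lra.
have -> : tent (x + t *: z) = 0.
  apply/eqP/negPn/negP => /(tent_line xr z1)[].
  by rewrite (gtr0_norm t0) (negbTE t1).
have -> : tent (x - t *: z) = 0.
  apply/eqP/negPn/negP; rewrite -scaleNr => /(tent_line xr z1)[].
  by rewrite normrN (gtr0_norm t0) (negbTE t1).
lra.
Qed.

Lemma integrable_tent x z : `|x| <= r -> enorm z = 1 ->
  mu.-integrable `]0, +oo[ (EFin \o (fun t => second_diff tent x z t / t `^ p)).
Proof.
move=> xr z1.
have := integrable_scale 2 (measurable_itv _)
  (kernel_tail_integrable hs (ltr01 : 0 < 1 :> R)).
apply: le_integrable => //.
  apply/measurable_EFinP/measurable_funTS/measurable_funM.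
    apply: measurable_second_diff; apply: continuous_line_measurable.
    exact: tent_continuous.
  exact: measurable_inv_powR.
move=> t; rewrite /= in_itv/= andbT => t0.
have [b0 b1] := andP (second_diff_tent xr z1 t0).
have tp : 0 <= (t `^ p)^-1 by rewrite invr_ge0 powR_ge0.
rewrite lee_fin normrM (ger0_norm b0) (ger0_norm tp) mulrA.
by apply: le_trans (ler_norm _); rewrite ler_wpM2r.
Qed.

Lemma tent_integral_ge0 x z : `|x| <= r -> enorm z = 1 ->
  0 <= tent_integral x z.
Proof.
move=> xr z1; apply: Rintegral_ge0 => t /=; rewrite in_itv/= andbT => t0.
by rewrite divr_ge0 ?powR_ge0//; case/andP: (second_diff_tent xr z1 t0).
Qed.

Lemma tent_integral_le x z : `|x| <= r -> enorm z = 1 ->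
  tent_integral x z <= 2 * kernel_tail s 1.
Proof.
move=> xr z1; have i := kernel_tail_integrable hs (ltr01 : 0 < 1 :> R).
rewrite /kernel_tail -RintegralZl//; apply: le_Rintegral => //.
- exact: integrable_tent.
- exact: integrable_scale.
move=> t /=; rewrite in_itv/= andbT => t0.
by rewrite mulrA ler_wpM2r ?invr_ge0 ?powR_ge0//;
  case/andP: (second_diff_tent xr z1 t0).
Qed.

Lemma tent_integral_eq0 x z : `|x| <= r -> enorm z = 1 ->
  [|| z 0 i0 == 0, z 0 i1 == 0 | 2 * `|z 0 i1| < `|z 0 i0|] ->
  tent_integral x z = 0.
Proof.
move=> xr z1 hz; rewrite /tent_integral.
have b t : tent (x + t *: z) = 0.
  apply/eqP/negPn/negP => /(tent_line xr z1)[_ /negbTE e0 /negbTE e1].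
  by move: hz; rewrite e0 e1/= ltNge => /negbTE ->.
rewrite (@eq_Rintegral _ _ _ mu _ (cst 0)) ?Rintegral_cst ?mul0r// => t _.
by rewrite /second_diff -scaleNr !b (tent_eq0 xr) mulr0 subr0 addr0 mul0r.
Qed.

Lemma second_diff_saddle x z t : second_diff saddle x z t =
  line_diff (spline p r) (x 0 i1) (z 0 i1) t -
  line_diff (spline p r) (x 0 i0) (z 0 i0) t.
Proof.
rewrite /second_diff /saddle /line_diff !mxE; move: (spline p r) => a.
move: (a _) (a (x 0 i0 + _)) (a (_ - _)) (a (x 0 i0 - _)) (a _) (a (x 0 i0)).
by move=> *; ring.
Qed.

(** Within [delta] the line stays in the cube, where the tent vanishes, so the splice with [saddle]
    changes nothing and the rest is linearity. *)
Lemma E_dir_bumped_saddle eta delta x z : 0 <= eta -> `|x| <= r -> 0 < delta ->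
  (forall y, eball x delta y -> `|y| <= r) -> enorm z = 1 ->
  E_dir s z delta (bumped_saddle eta) saddle x =
  kappa * (`|z 0 i0| `^ (p - 1) - `|z 0 i1| `^ (p - 1)) +
  eta * tent_integral x z.
Proof.
move=> e0 xr d0 dr z1.
have [C hC] := bumped_saddle_bounded e0.
have [_ ->] :=
  E_dirE_C2 hs x d0 C2_saddle (@bumped_saddle_continuous eta) hC z1.
have x0 := le_trans (coord_le_norm x i0) xr.
have x1 := le_trans (coord_le_norm x i1) xr.
have [j0 E0] := spline_line_operator hp (z 0 i0) r0 x0.
have [j1 E1] := spline_line_operator hp (z 0 i1) r0 x1.
have jb := integrable_tent xr z1.
have jb' := integrable_scale eta (measurable_itv _) jb.
rewrite (@eq_Rintegral _ _ _ mu _ (fun t =>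
  (line_diff (spline p r) (x 0 i1) (z 0 i1) t / t `^ p -
   line_diff (spline p r) (x 0 i0) (z 0 i0) t / t `^ p) +
  eta * (second_diff tent x z t / t `^ p))); last first.
  move=> t; rewrite inE/= in_itv/= andbT => t0.
  have sE : second_diff (bumped_saddle eta) x z t =
      second_diff saddle x z t + eta * second_diff tent x z t.
    rewrite /second_diff /bumped_saddle.
    move: (saddle _) (saddle (_ - _)) (saddle x).
    move: (tent _) (tent (_ - _)) (tent x).
    by move=> a b c a' b' c'; ring.
  rewrite mulrA -mulrBl -mulrDl -second_diff_saddle -sE; congr (_ / _).
  rewrite /spliced_diff; case: ifPn => // td; rewrite sE.
  have nt : `|t| < delta by rewrite gtr0_norm.
  have bp : tent (x + t *: z) = 0 by apply/tent_eq0/dr/eball_line.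
  have bm : tent (x - t *: z) = 0.
    by rewrite -scaleNr; apply/tent_eq0/dr/eball_line; rewrite ?normrN.
  by rewrite {3}/second_diff bp bm (tent_eq0 xr) mulr0 subr0 addr0 mulr0 addr0.
rewrite RintegralD//; last first.
  exact: (@integrableB _ _ _ mu _ (measurable_itv _) _ _ j1 j0).
rewrite RintegralB// RintegralZl// E0 E1 -/(tent_integral x z) /kappa.
ring.
Qed.

(** The factor 8 makes the bump contribute at most kappa / 4, its integral being at most twice the
    tail. Where it contributes, the saddle gives at most 3 kappa / 4, so the maximum stays kappa;
    the minimum survives because the bump only adds and misses the axes. *)
Lemma saddle_balanced pb eta delta x : (2 <= N)%N ->
  0 <= eta -> 8 * (eta * kernel_tail s 1) <= kappa ->
  `|x| <= r -> 0 < delta -> (forall y, eball x delta y -> `|y| <= r) ->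
  sphere_functional pb
    (fun z => E_dir s z delta (bumped_saddle eta) saddle x) = 0.
Proof.
move=> N2 e0 ek xr d0 dr.
have k0 := kappa_gt0.
pose F z := E_dir s z delta (bumped_saddle eta) saddle x.
have FE z : enorm z = 1 -> F z =
    kappa * (`|z 0 i0| `^ (p - 1) - `|z 0 i1| `^ (p - 1)) +
    eta * tent_integral x z.
  exact: E_dir_bumped_saddle.
have q0 : 0 < p - 1 by case/andP: hs => *; lra.
have q2 : p - 1 <= 2 by case/andP: hs => *; lra.
have pow1 z i : enorm z = 1 -> 0 <= `|z 0 i| `^ (p - 1) <= 1.
  have e1 : (1 : R) `^ (p - 1) = 1 by rewrite powR1.
  move=> z1; rewrite powR_ge0/= -[leRHS]e1.
  apply: ge0_ler_powR; rewrite ?nnegrE ?(ltW q0)//.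
  by rewrite -z1 (le_trans (coord_le_norm _ _))// norm_le_enorm.
have pow0 : `|0 : R| `^ (p - 1) = 0 by rewrite normr0 powR0// gt_eqF.
have tent0 z : enorm z = 1 -> z 0 i0 = 0 \/ z 0 i1 = 0 -> tent_integral x z = 0.
  move=> z1 zz; apply: tent_integral_eq0 => //.
  by case: zz => ->; rewrite eqxx ?orbT.
have quarter (b : R) : 0 <= b ->
    (b / 2) `^ (p - 1) = b `^ (p - 1) * 2^-1 `^ (p - 1).
  by move=> b0; rewrite powRM// invr_ge0.
(* This uses 2s <= 2: halving a number divides its power 2s by at most 4. *)
have q4 : 4^-1 <= (2^-1 : R) `^ (p - 1).
  have -> : (4^-1 : R) = 2^-1 `^ 2.
    by rewrite (powR_mulrn 2) ?invr_ge0// expr2; field.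
  by apply: ger_powR => //; rewrite invr_gt0 ltr0n/= invf_le1// ler1n.
have unit_coord (i j : 'I_N) :
    `|(delta_mx 0 i : 'rV[R]_N) 0 j| `^ (p - 1) = (j == i)%:R.
  rewrite mxE eqxx/=; case: eqP => _; first by rewrite normr1 powR1.
  exact: pow0.
have i10 : (i1 == i0) = false by rewrite eq_sym; exact: negbTE.
have coord0 (i j : 'I_N) : (j == i) = false ->
    (delta_mx 0 i : 'rV[R]_N) 0 j = 0.
  by move=> ji; rewrite mxE eqxx ji.
have oppE (v : 'rV[R]_N) j : (- v) 0 j = - v 0 j by rewrite mxE.
apply: (@sphere_functional_balanced _ _ _ F kappa i0 i1).
- exact: N2.
- move=> z z1; rewrite FE//.
  have [a0 a1] := andP (pow1 z i0 z1); have [b0 b1] := andP (pow1 z i1 z1).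
  have B0 := tent_integral_ge0 xr z1; have B1 := tent_integral_le xr z1.
  have eB0 : 0 <= eta * tent_integral x z by rewrite mulr_ge0.
  have eB1 : 4 * (eta * tent_integral x z) <= kappa.
    by have := ler_wpM2l e0 B1; lra.
  have k1 := ler_wpM2l (ltW k0) b1; have k2 := ler_wpM2l (ltW k0) a1.
  have k3 := mulr_ge0 (ltW k0) b0; have k4 := mulr_ge0 (ltW k0) a0.
  rewrite ler_norml mulrBr; apply/andP; split; first lra.
  (* Either the line misses the tent, or |z_0| <= 2 |z_1|; the latter turns a - b into at most 3 a /
     4. *)
  have [hz|] := boolP [|| z 0 i0 == 0, z 0 i1 == 0 | 2 * `|z 0 i1| < `|z 0 i0|].
    by rewrite (tent_integral_eq0 xr z1 hz) mulr0; lra.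
  rewrite !negb_or -leNgt => /and3P[_ _ z01].
  have z01' : `|z 0 i0| / 2 <= `|z 0 i1| by lra.
  have h : `|z 0 i0| `^ (p - 1) / 4 <= `|z 0 i1| `^ (p - 1).
    apply: (@le_trans _ _ ((`|z 0 i0| / 2) `^ (p - 1))).
      by rewrite quarter// ler_wpM2l.
    by apply: ge0_ler_powR; rewrite ?nnegrE ?(ltW q0)// divr_ge0.
  have := ler_wpM2l (ltW k0) h; lra.
- move=> z z1 z0; rewrite FE// z0 pow0 sub0r (tent0 z z1) ?mulr0 ?addr0;
    last by left.
  by rewrite mulrN oppr_le0 mulr_ge0 ?powR_ge0// ltW.
- move=> z z1 z0; rewrite FE// z0 pow0 subr0 (tent0 z z1) ?mulr0 ?addr0;
    last by right.
  by rewrite mulr_ge0 ?powR_ge0// ltW.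
- rewrite FE ?enorm_delta// !unit_coord eqxx i10 subr0 mulr1.
  by rewrite tent0 ?enorm_delta ?mulr0 ?addr0//; right; exact: coord0.
- rewrite FE ?enormN ?enorm_delta// !oppE !normrN !unit_coord eqxx i10.
  rewrite subr0 mulr1 tent0 ?enormN ?enorm_delta ?mulr0 ?addr0//; right.
  by rewrite oppE coord0// oppr0.
- rewrite FE ?enorm_delta// !unit_coord eqxx (negbTE i01) sub0r mulrN1.
  rewrite tent0 ?enorm_delta ?mulr0 ?addr0//; left.
  by apply: coord0; exact: negbTE.
Qed.

Lemma tent_far_point : tent far_point = 1.
Proof. by rewrite /tent subrr normr0 subr0; apply/max_idPr. Qed.

End Construction.

(** * The difference of the two solutions does not solve the equation *)

Section BumpSolution.
Context {R : realType} {N : nat}.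
Local Notation mu := (@lebesgue_measure R).
Variables (s r : R) (i0 i1 : 'I_N).
Hypotheses (hs : 2^-1 < s < 1) (r0 : 0 < r).
Implicit Types (x y z : 'rV[R]_N) (t eta delta : R).

Local Notation p := (1 + 2 * s).
Local Notation tent := (tent r i0 i1).
Local Notation tent_integral := (tent_integral s r i0 i1).

Lemma E_dir_tent eta delta x z : 0 <= eta -> `|x| <= r -> 0 < delta ->
  (forall y, eball x delta y -> `|y| <= r) -> enorm z = 1 ->
  E_dir s z delta (fun y => eta * tent y) (fun=> 0) x = eta * tent_integral x z.
Proof.
move=> e0 xr d0 dr z1.
have cb : continuous (fun y => eta * tent y).
  by move=> y; apply: continuous_scale; exact: tent_continuous.
have bb y : `|eta * tent y| <= eta.
  by rewrite ger0_norm ?mulr_ge0 ?tent_ge0// ler_piMr// tent_le1.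
have [_ ->] := E_dirE_C2 hs x d0 (C2_cst (0 : R)) cb bb z1.
rewrite -RintegralZl//; last exact: integrable_tent.
apply: eq_Rintegral => t; rewrite inE/= in_itv/= andbT => t0.
rewrite mulrA; congr (_ / _).
have sE : second_diff (fun y => eta * tent y) x z t =
    eta * second_diff tent x z t.
  by rewrite /second_diff; ring.
rewrite /spliced_diff sE; case: ifPn => // td.
have nt : `|t| < delta by rewrite gtr0_norm.
have bp : tent (x + t *: z) = 0.
  by apply: tent_eq0 => //; apply: dr; exact: eball_line.
have bm : tent (x - t *: z) = 0.
  rewrite -scaleNr; apply: tent_eq0 => //.
  by apply: dr; apply: eball_line; rewrite ?normrN.
by rewrite /second_diff bp bm (tent_eq0 _ _ r0 xr) !mulr0 !subr0 !addr0 mulr0.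
Qed.

(** The direction is the one that points from [x] to the peak of the tent. *)
Lemma tent_integral_gt0 x : `|x| <= r ->
  exists2 z, enorm z = 1 & 0 < tent_integral x z.
Proof.
move=> xr; set q := far_point r i0 i1.
have bx := tent_eq0 i0 i1 r0 xr.
have xq : 1 <= `|q - x|.
  rewrite leNgt distrC; apply/negP => xq; move: bx; rewrite /tent.
  by rewrite (max_idPr _) ?subr_ge0 ?(ltW xq)//; move: xq; rewrite -/q; lra.
pose T := enorm (q - x).
have T1 : 1 <= T by apply: le_trans xq (norm_le_enorm _).
have z1 : enorm (T^-1 *: (q - x)) = 1.
  apply: enorm_normalize; rewrite -enorm_eq0 gt_eqF// -/T; lra.
exists (T^-1 *: (q - x)) => //; set z := T^-1 *: _.
have zn : `|z| <= 1 by rewrite -z1 norm_le_enorm.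
have Tz : T *: z = q - x by rewrite scalerA divff ?scale1r// gt_eqF//; lra.
(* At parameter [T] the line is at the peak. A Euclidean unit vector has sup norm at most 1, so half
   a unit of parameter costs at most half of the height. *)
have half t : T - 2^-1 <= t <= T + 2^-1 -> 2^-1 <= second_diff tent x z t.
  move=> ht; rewrite /second_diff bx mulr0 subr0.
  have b1 : 2^-1 <= tent (x + t *: z).
    rewrite /tent le_max; apply/orP; right.
    have -> : x + t *: z - far_point r i0 i1 = (t - T) *: z.
      by rewrite scalerBl Tz -/q opprB addrCA addrA.
    rewrite normrZ.
    have : `|t - T| * `|z| <= 2^-1 * 1.
      by rewrite ler_pM// ler_norml; lra.
    lra.
  by have := tent_ge0 r i0 i1 (x - t *: z); lra.
have [p2 p3] := andP (exponent_bounds hs).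
apply: (@Rintegral_gt0 _ _ (T - 2^-1) (T + 2^-1) (2^-1 * ((T + 2^-1) `^ p)^-1)).
- by apply/andP; lra.
- by rewrite mulr_gt0 ?invr_gt0 ?powR_gt0//; lra.
- exact: integrable_tent.
- move=> t t0; rewrite divr_ge0 ?powR_ge0//.
  by case/andP: (second_diff_tent i0 i1 r0 xr z1 t0).
move=> t ht; have [t1 t2] := andP ht.
apply: ler_pM; rewrite ?invr_ge0 ?powR_ge0 ?half//.
rewrite lef_pV2 ?posrE ?powR_gt0//; [|lra..].
by apply: ge0_ler_powR; rewrite ?nnegrE; lra.
Qed.

(** In Omega the bump attains its global minimum 0, so the zero function touches it from below. All
    directions then see a nonnegative line operator, and the direction of the peak a positive one,
    which contradicts the supersolution inequality. *)
Lemma tent_not_solution pb Omega eta : (0 < N)%N -> 0 < eta ->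
  open Omega -> Omega !=set0 -> (forall x, Omega x -> `|x| <= r) ->
  ~ viscosity_solution pb s Omega
      (fun x => eta * tent x) (fun x => eta * tent x).
Proof.
move=> N0 e0 oO [x Ox] Or [_ [_ _ _ super]].
have [d d0 dO] := open_eball oO Ox.
have touch y : eball x d y -> eta * tent x - 0 <= eta * tent y - 0.
  move=> _; rewrite (tent_eq0 _ _ r0 (Or _ Ox)) mulr0 !subr0.
  by rewrite mulr_ge0 ?tent_ge0 ?ltW.
have [/(_ Ox)+ _] := super d (fun=> 0) x d0 (C2_cst _) touch.
rewrite lower_ext_id// E_opE oppr_ge0 leNgt => /negP; apply.
have dr y : eball x d y -> `|y| <= r by move=> /dO/Or.
have [z z1 Fz] := tent_integral_gt0 (Or _ Ox).
have FE v : enorm v = 1 ->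
    E_dir s v d (fun y => eta * tent y) (fun=> 0) x = eta * tent_integral x v.
  by apply: E_dir_tent; rewrite ?(ltW e0) ?Or.
apply: (@sphere_functional_gt0 _ _ _ _ (eta * (2 * kernel_tail s 1)) z).
- exact: N0.
- move=> v v1; rewrite FE// mulr_ge0 ?(ltW e0) ?tent_integral_ge0 ?Or//=.
  by rewrite ler_wpM2l ?(ltW e0)// tent_integral_le ?Or.
- exact: z1.
- by rewrite FE// mulr_gt0.
have Nz1 : enorm (- z) = 1 by rewrite enormN.
by rewrite (FE _ Nz1) (FE _ z1) tent_integralN.
Qed.

End BumpSolution.

Theorem theorem1p3 (R : realType) (N : nat) (s : R) (Omega : set 'rV[R]_N)
    (HN : (2 <= N)%N) (Hs : 2^-1 < s < 1) (HOmega : bounded_C2_domain Omega)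
    (p : dirichlet_problem) :
  ~ linear_problem p s Omega /\
  exists g1 g2 : 'rV[R]_N -> R,
    [/\ exterior_datum Omega g1, exterior_datum Omega g2,
        forall x, ~ Omega x -> g2 x <= g1 x,
        exists2 x, ~ Omega x & g1 x <> g2 x &
        exists u1 u2 : 'rV[R]_N -> R,
          [/\ the_viscosity_solution p s Omega g1 u1,
              the_viscosity_solution p s Omega g2 u2 &
              forall x, Omega x -> u1 x = u2 x]].
Proof.
have [neO oO _ [B [_ hB]] _] := HOmega.
(* The profile has to be flat on the whole range of the coordinates in Omega, so [r] is a sup-norm
   bound for Omega. *)
pose r := `|B| + 1.
have r0 : 0 < r by have := normr_ge0 B; rewrite /r; lra.
have Br : B < r by have := ler_norm B; rewrite /r; lra.
have Or x : Omega x -> `|x| <= r by move=> Ox; exact: (hB _ Br _ Ox).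
have N0 : (0 < N)%N by exact: ltnW.
pose i0 := Ordinal N0; pose i1 := Ordinal HN.
have i01 : i0 != i1 by [].
have k0 := kappa_gt0 Hs r0; have T0 := kernel_tail_gt0 Hs ltr01.
(* The largest height allowed by [saddle_balanced]. *)
pose eta0 := kappa s r / (8 * kernel_tail s 1).
have e00 : 0 < eta0 by rewrite divr_gt0// mulr_gt0.
have e0K : 8 * (eta0 * kernel_tail s 1) = kappa s r.
  by rewrite /eta0; field; rewrite gt_eqF.
pose U eta := bumped_saddle s r i0 i1 eta.
have tent0 x : Omega x -> tent r i0 i1 x = 0 by move=> /Or; exact: tent_eq0.
have sol eta : 0 <= eta -> 8 * (eta * kernel_tail s 1) <= kappa s r ->
    the_viscosity_solution p s Omega (U eta) (U eta).
  move=> e0 ek; have [C hC] := bumped_saddle_bounded r i0 i1 Hs e0.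
  apply: (@classical_the_viscosity_solution _ _ _ _ _ Hs N0 HOmega _
    (saddle s r i0 i1) C) => //.
  - exact: bumped_saddle_continuous.
  - exact: C2_saddle.
  - by move=> x Ox; rewrite /U /bumped_saddle tent0// mulr0 addr0.
  move=> x delta Ox d0 dO; apply: saddle_balanced => //; first exact: Or.
  by move=> y /dO/Or.
have datum eta : 0 <= eta -> exterior_datum Omega (U eta).
  move=> e0; have [C hC] := bumped_saddle_bounded r i0 i1 Hs e0; split.
    by apply: continuous_subspaceT; exact: bumped_saddle_continuous.
  exists C; split; first exact: num_real.
  by move=> K CK x _; exact: le_trans (hC x) (ltW CK).
have sol1 : the_viscosity_solution p s Omega (U eta0) (U eta0).
  by apply: sol; rewrite ?e0K// ltW.
have sol2 : the_viscosity_solution p s Omega (U 0) (U 0).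
  by apply: sol; rewrite // mul0r mulr0 ltW.
have UB : (fun x => -1 * U 0 x + U eta0 x) = (fun x => eta0 * tent r i0 i1 x).
  by apply/funext => x; rewrite /U /bumped_saddle; ring.
split.
  (* With the coefficient -1 superposition would make the bump [eta0 * tent] a solution for its own
     values. *)
  move=> /(_ (-1) _ _ _ _ (datum _ (lexx 0)) (datum _ (ltW e00)) sol2.1 sol1.1).
  by rewrite UB; exact: tent_not_solution.
exists (U eta0), (U 0); split; [exact/datum/ltW|exact: datum| | |].
- move=> x _; rewrite /U /bumped_saddle lerD2l mul0r.
  by rewrite mulr_ge0 ?tent_ge0// ltW.
- exists (far_point r i0 i1).
    by move=> /tent0; rewrite tent_far_point => /eqP; rewrite oner_eq0.
  rewrite /U /bumped_saddle tent_far_point mul0r !mulr1 addr0 => /eqP.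
  by rewrite -subr_eq0 addrAC subrr add0r gt_eqF.
exists (U eta0), (U 0); split => // x Ox.
by rewrite /U /bumped_saddle tent0// !mulr0.
Qed.
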